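(* Let $m\ge n$, let $H,H_1,\dots,H_p\in\mathbb{C}^{m\times n}$ with $H$ of full column rank, $y,y_1,\dots,y_p\in\mathbb{C}^m$, and $\delta_\alpha,\delta_\beta\ge 0$. With $\kappa$, $d$, $b$, $G$, $Q$ and the structured approximate regret $R_s$ as in the context, for every $x\in\mathbb{C}^n$ and $\gamma\in\mathbb{R}$, $R_s(x;\alpha,\beta)\le\gamma$ holds for all $\alpha,\beta\in\mathbb{C}^p$ with $\|\alpha\|\le\delta_\alpha$, $\|\beta\|\le\delta_\beta$ if and only if there exist $\tau_1,\tau_2\ge 0$ with $$\begin{bmatrix} \gamma+\kappa-\tau_1-\tau_2 & (y-Hx)^H & \delta_\alpha d^H & \delta_\beta b^H\\ y-Hx & I_m & -\delta_\alpha G & \delta_\beta Q\\ \delta_\alpha d & -\delta_\alpha G^H & \tau_1 I_p & 0\\ \delta_\beta b & \delta_\beta Q^H & 0 & \tau_2 I_p \end{bmatrix}\succeq 0 .$$ Consequently, $\min_{x}\max_{\|\alpha\|\le\delta_\alpha,\|\beta\|\le\delta_\beta}R_s(x;\alpha,\beta)$ equals the optimal value of minimizing $\gamma$ over $(\gamma,x,\tau_1,\tau_2)$ subject to $\tau_1,\tau_2\ge0$ and this matrix inequality.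
   Context: For $\alpha=(\alpha_1,\dots,\alpha_p)^T,\beta=(\beta_1,\dots,\beta_p)^T\in\mathbb{C}^p$ the structured perturbed data are $\tilde H = H+\sum_{i=1}^p\alpha_iH_i$ and $\tilde y = y+\sum_{i=1}^p\beta_iy_i$. Let $H^+$ be the Moore–Penrose pseudo-inverse, $P = I_m - HH^+$, $\kappa = y^HPy$, $d\in\mathbb{C}^p$ with $d_i = -\overline{y^HPH_iH^+y}$, and $b\in\mathbb{C}^p$ with $b_i = \overline{y^HPy_i}$. Let $G = [H_1x,\dots,H_px]\in\mathbb{C}^{m\times p}$ and $Q=[y_1,\dots,y_p]\in\mathbb{C}^{m\times p}$. The structured approximate regret is $$R_s(x;\alpha,\beta) = \|\tilde y-\tilde Hx\|^2 - \big(\kappa + d^H\alpha+\alpha^Hd + b^H\beta+\beta^Hb\big).$$ $\|\cdot\|$ is the Euclidean norm; $A\succeq 0$ means Hermitian positive semidefinite. *)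

(* Defs.v *)
From HB Require Import structures.
From mathcomp Require Import all_boot all_order all_algebra.
Set Implicit Arguments. Unset Strict Implicit. Unset Printing Implicit Defensive.
Import Order.TTheory GRing.Theory Num.Theory.
Local Open Scope ring_scope.

Section Defs.
Variable C : numClosedFieldType.

Definition ctr (r c : nat) (A : 'M[C]_(r, c)) : 'M[C]_(c, r) :=
  map_mx Num.conj (A ^T).

Definition vnorm (k : nat) (v : 'cV[C]_k) : C := sqrtC ((ctr v *m v) 0 0).

Definition psd (k : nat) (A : 'M[C]_k) : Prop :=
  ctr A = A /\ forall v : 'cV[C]_k, 0 <= (ctr v *m A *m v) 0 0.

Definition is_pinv (r c : nat) (A : 'M[C]_(r, c)) (X : 'M[C]_(c, r)) : Prop :=
  [/\ A *m X *m A = A, X *m A *m X = X,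
      ctr (A *m X) = A *m X & ctr (X *m A) = X *m A].

Variables (m n p : nat).
Variables (H : 'M[C]_(m, n)) (Hs : 'I_p -> 'M[C]_(m, n)).
Variables (y : 'cV[C]_m) (ys : 'I_p -> 'cV[C]_m).
Variable (Hp : 'M[C]_(n, m)). (* H^+ *)

Definition Pproj : 'M[C]_m := 1%:M - H *m Hp.
Definition kappa : C := (ctr y *m Pproj *m y) 0 0.
Definition dvec : 'cV[C]_p :=
  \col_i (- Num.conj ((ctr y *m Pproj *m Hs i *m Hp *m y) 0 0)).
Definition bvec : 'cV[C]_p := \col_i (Num.conj ((ctr y *m Pproj *m ys i) 0 0)).
Definition Gmat (x : 'cV[C]_n) : 'M[C]_(m, p) := \matrix_(i, j) (Hs j *m x) i 0.
Definition Qmat : 'M[C]_(m, p) := \matrix_(i, j) ys j i 0.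

Definition Htilde (a : 'cV[C]_p) : 'M[C]_(m, n) := H + \sum_i a i 0 *: Hs i.
Definition ytilde (b : 'cV[C]_p) : 'cV[C]_m := y + \sum_i b i 0 *: ys i.

Definition Rs (x : 'cV[C]_n) (a b : 'cV[C]_p) : C :=
  vnorm (ytilde b - Htilde a *m x) ^+ 2
  - (kappa + (ctr dvec *m a) 0 0 + (ctr a *m dvec) 0 0
           + (ctr bvec *m b) 0 0 + (ctr b *m bvec) 0 0).

Definition LMI (da db g t1 t2 : C) (x : 'cV[C]_n) : 'M[C]_((1 + m) + (p + p)) :=
  let r := y - H *m x in
  block_mx
    (block_mx ((g + kappa - t1 - t2)%:M : 'M[C]_1) (ctr r) r (1%:M : 'M[C]_m))
    (block_mx (da *: ctr dvec) (db *: ctr bvec) (- (da *: Gmat x)) (db *: Qmat))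
    (block_mx (da *: dvec) (- (da *: ctr (Gmat x))) (db *: bvec) (db *: ctr Qmat))
    (block_mx (t1%:M : 'M[C]_p) 0 0 (t2%:M : 'M[C]_p)).

Definition admissible (da db : C) (a b : 'cV[C]_p) : Prop :=
  vnorm a <= da /\ vnorm b <= db.

Definition worst_value (da db : C) (x : 'cV[C]_n) (v : C) : Prop :=
  (exists a b, admissible da db a b /\ Rs x a b = v) /\
  (forall a b, admissible da db a b -> Rs x a b <= v).

Definition minmax_value (da db : C) (v : C) : Prop :=
  (exists x, worst_value da db x v) /\
  (forall x w, worst_value da db x w -> v <= w).

Definition lmi_feasible (da db g : C) (x : 'cV[C]_n) (t1 t2 : C) : Prop :=
  [/\ g \is Num.real, 0 <= t1, 0 <= t2 & psd (LMI da db g t1 t2 x)].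

Definition sdp_value (da db : C) (v : C) : Prop :=
  (exists x t1 t2, lmi_feasible da db v x t1 t2) /\
  (forall g x t1 t2, lmi_feasible da db g x t1 t2 -> v <= g).

End Defs.

(* Main.v *)
Require Import Defs.
From HB Require Import structures.
From mathcomp Require Import all_boot all_order all_algebra.
From mathcomp Require Import zify ring lra.
From mathcomp Require Import polyrcf ordered_qelim qe_rcf.
Set Implicit Arguments. Unset Strict Implicit. Unset Printing Implicit Defensive.
Import Order.TTheory GRing.Theory Num.Theory.
Local Open Scope ring_scope.

(** With [alpha = da u] and [beta = db v], the difference [g - Rs] is the value at
    [z = (1, u, v)] of a Hermitian form [F0], and eliminating the identity block
    of the linear matrix inequality (a Schur complement) turns it into
    [F0 - t1 F1 - t2 F2 >= 0], where [F1 z = |t|^2 - |u|^2] and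
    [F2 z = |t|^2 - |v|^2] for [z = (t, u, v)].  The equivalence is thus an
    S-lemma with two constraints.  It is lossless over the complex numbers because
    the joint range of three Hermitian forms is a convex cone; the multipliers are
    found one at a time, as suprema of the slopes that the cone imposes.

    The field is an arbitrary algebraically closed field with conjugation, so its
    real part is a real closed field and need not be complete.  Suprema are taken
    only of definable sets, where they exist by quantifier elimination, and the
    inner maximum is attained by the extreme value theorem for polynomials over a
    real closed field.  The two optimal values then coincide because an attained
    worst case is itself a feasible level of the semidefinite program. *)

(** * The real part of a numeric closed field *)

Section RealPart.
Variable C : numClosedFieldType.

(** The real elements are made a type of their own so that results about an [rcfType], quantifier
    elimination above all, apply inside [C]. *)
Record realpart := RealPart {rp_val :> C; rp_valP : rp_val \is Num.real}.

HB.instance Definition _ := [isSub for rp_val].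
HB.instance Definition _ := [Choice of realpart by <:].
HB.instance Definition _ := [SubChoice_isSubIntegralDomain of realpart by <:].
HB.instance Definition _ := [SubIntegralDomain_isSubField of realpart by <:].
HB.instance Definition _ : Order.isPOrder ring_display realpart :=
  Order.CancelPartial.Pcan _ valK.

Fact realpart_total : total (<=%O : rel (realpart : porderType _)).
Proof. by move=> x y; apply/real_leVge/valP/valP. Qed.
HB.instance Definition _ := Order.POrder_isTotal.Build _ realpart realpart_total.

Fact rp_val_is_zmod_morphism : zmod_morphism rp_val. Proof. by []. Qed.
HB.instance Definition _ :=
  GRing.isZmodMorphism.Build realpart C rp_val rp_val_is_zmod_morphism.
Fact rp_val_is_monoid_morphism : monoid_morphism rp_val. Proof. by []. Qed.
HB.instance Definition _ :=
  GRing.isMonoidMorphism.Build realpart C rp_val rp_val_is_monoid_morphism.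

Definition rp_norm (x : realpart) : realpart := RealPart (normr_real (rp_val x)).

Fact rp_normD x y : rp_norm (x + y) <= rp_norm x + rp_norm y.
Proof. exact: ler_normD. Qed.
Fact rp_norm_eq0 x : rp_norm x = 0 -> x = 0.
Proof. by move=> /(congr1 val)/normr0_eq0 ?; apply/val_inj. Qed.
Fact rp_normMn x n : rp_norm (x *+ n) = rp_norm x *+ n.
Proof. by apply/val_inj; rewrite /= !rmorphMn/= normrMn. Qed.
Fact rp_normN x : rp_norm (- x) = rp_norm x.
Proof. by apply/val_inj; apply: normrN. Qed.
Fact rp_addr_gt0 (x y : realpart) : 0 < x -> 0 < y -> 0 < x + y.
Proof. exact: (@addr_gt0 C). Qed.
Fact rp_ger_leVge (x y : realpart) : 0 <= x -> 0 <= y -> (x <= y) || (y <= x).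
Proof. by move=> *; exact: realpart_total. Qed.
Fact rp_normM : {morph rp_norm : x y / x * y}.
Proof. by move=> *; apply/val_inj; apply: normrM. Qed.
Fact rp_ler_def (x y : realpart) : (x <= y) = (rp_norm (y - x) == y - x).
Proof. exact: (@ler_def C). Qed.

HB.instance Definition _ := Num.Zmodule_isNormed.Build _ realpart
  rp_normD rp_norm_eq0 rp_normMn rp_normN.
HB.instance Definition _ := Num.isNumRing.Build realpart
  rp_addr_gt0 rp_ger_leVge rp_normM rp_ler_def.

(** The product is [(X - Re z)^2 + (Im z)^2], positive everywhere because [Im z] is nonzero. *)
Lemma realpart_conjugate_factor (z : C) : z \isn't Num.real ->
  exists m : {poly realpart},
    [/\ map_poly rp_val m = ('X - z%:P) * ('X - z^*%:P),
      size m = 3%N & forall a, 0 < m.[a]].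
Proof.
move=> zNR.
pose re := RealPart (Creal_Re z); pose im := RealPart (Creal_Im z).
exists (('X - re%:P) ^+ 2 + (im ^+ 2)%:P).
have mE : map_poly rp_val (('X - re%:P) ^+ 2 + (im ^+ 2)%:P)
  = ('X - z%:P) * ('X - z^*%:P).
  rewrite rmorphD rmorphXn rmorphB /= map_polyX !(map_polyC rp_val) /=.
  have zc : z^* = 'Re z - 'i * 'Im z.
    by rewrite {1}[z]Crect conjC_rect ?Creal_Re ?Creal_Im.
  rewrite zc; have -> : ('X - z%:P) = ('X - ('Re z + 'i * 'Im z)%:P).
    by rewrite -Crect.
  have i2 : ('i : C)%:P ^+ 2 = -1 by rewrite -polyC_exp sqrCi polyCN.
  rewrite !(polyCD, polyCN, polyCM, rmorphXn) /=. ring: i2.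
split=> //.
  by rewrite -(size_map_poly rp_val) mE size_mul ?polyXsubC_eq0 // !size_XsubC.
move=> a; rewrite !hornerE ltr_wpDl ?sqr_ge0 // exprn_even_gt0 //=.
apply: contra zNR => /eqP/(congr1 rp_val)/= im0.
by apply/Creal_ImP.
Qed.

(** Induction on the degree: a root in [C] that does not lie in [[a, b]] is split off with a real
    factor of equal signs at [a] and [b], and the quotient keeps a sign change. *)
Fact realpart_rcf : Num.real_closed_axiom realpart.
Proof.
move=> p a b le_ab /andP[pa_le0 pb_ge0].
(* The sign change is kept in a symmetric form, since a factor negative at both ends reverses the
   signs of the quotient. *)
have {pa_le0 pb_ge0} : p.[a] * p.[b] <= 0 by rewrite mulr_le0_ge0.
have [n] := ubnP (size p); elim: n p => // n IHn p; rewrite ltnS => szp pab.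
have [sz1|/closed_rootP[z rz]] := boolP (size (map_poly rp_val p) == 1).
  exists a; first by rewrite lexx.
  move: sz1 pab; rewrite size_map_poly => /size_poly1P[c c0 ->].
  by rewrite !hornerE leNgt -expr2 exprn_even_gt0 // c0 orbT.

have [->|p0] := eqVneq p 0; first by exists a; rewrite ?lexx ?root0.
have descend (q m : {poly realpart}) : p = q * m -> (1 < size m)%N ->
    0 < m.[a] * m.[b] -> exists2 x, a <= x <= b & root p x.
  move=> pE szm mab; case: (IHn q) => [||x xab rx].
  - have := p0; rewrite pE mulf_eq0 negb_or => /andP[q0 m0].
    move: szp; rewrite pE size_mul //; apply: leq_trans.
    by move: (size q) (size m) szm q0 => ? ?; rewrite -?size_poly_gt0; lia.
  - by move: pab; rewrite pE !hornerM mulrACA pmulr_lle0.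
  by exists x => //; rewrite pE rootM rx.
have [zR|zNR] := boolP (z \is Num.real).
  pose x := RealPart zR.
  have rx : root p x by rewrite -(mapf_root rp_val).
  have [xab|] := boolP (a <= x <= b); first by exists x.
  move: (rx) => /factor_theorem[q qE] xNab.
  apply: (descend _ _ qE); rewrite ?size_XsubC // !hornerE.
  move: xNab; rewrite negb_and -!ltNge => /orP[xa|bx].
    by rewrite mulr_gt0 ?subr_gt0 // (lt_le_trans xa).
  by rewrite nmulr_lgt0 ?subr_lt0 // (le_lt_trans le_ab).
have [m [mE szm m_gt0]] := realpart_conjugate_factor zNR.
have /dvdpP[q qE] : m %| p.
  rewrite -(dvdp_map rp_val) mE Gauss_dvdp ?dvdp_XsubCl ?rz /=.
    (* Real coefficients make [p] vanish at the conjugate of [z] too. *)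
    have /eq_map_poly pE : rp_val =1 Num.conj \o rp_val.
      by move=> x /=; rewrite (CrealP (rp_valP x)).
    by rewrite pE map_poly_comp mapf_root.
  by rewrite coprimep_XsubC2 // subr_eq0 -CrealE.
by apply: (descend q m); rewrite // ?szm // mulr_gt0.
Qed.
HB.instance Definition _ := Num.RealField_isClosed.Build realpart realpart_rcf.
End RealPart.

(** * Definable sets over a real closed field *)

Section Definable.
Variable R : rcfType.
Implicit Types (e l : seq R) (F G : seq R -> R) (P Q : seq R -> Prop).

(** Polynomial functions are given by ring terms without inverses so that they can occur in
    first-order formulas. *)
Definition polyfun F :=
  exists2 t : GRing.term R, GRing.rterm t & forall e, GRing.eval e t = F e.

Lemma polyfun_ext F G : F =1 G -> polyfun F -> polyfun G.
Proof. by move=> FG [t rt tE]; exists t => // e; rewrite tE. Qed.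

Lemma polyfun_const c : polyfun (fun=> c).
Proof. by exists (GRing.Const c). Qed.

Lemma polyfun_nth i : polyfun (fun e => e`_i).
Proof. by exists (GRing.Var R i). Qed.

Lemma polyfunD F G : polyfun F -> polyfun G -> polyfun (fun e => F e + G e).
Proof.
move=> [t rt tE] [u ru uE]; exists (GRing.Add t u); first by rewrite /= rt.
by move=> e; rewrite /= tE uE.
Qed.

Lemma polyfunN F : polyfun F -> polyfun (fun e => - F e).
Proof. by move=> [t rt tE]; exists (GRing.Opp t) => // e; rewrite /= tE. Qed.

Lemma polyfunM F G : polyfun F -> polyfun G -> polyfun (fun e => F e * G e).
Proof.
move=> [t rt tE] [u ru uE]; exists (GRing.Mul t u); first by rewrite /= rt.
by move=> e; rewrite /= tE uE.
Qed.

Lemma polyfunB F G : polyfun F -> polyfun G -> polyfun (fun e => F e - G e).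
Proof. by move=> pF pG; apply/polyfunD/polyfunN. Qed.

Lemma polyfun_sum (I : Type) (r : seq I) (F : I -> seq R -> R) :
  (forall i, polyfun (F i)) -> polyfun (fun e => \sum_(i <- r) F i e).
Proof.
move=> pF; elim: r => [|i r IHr].
  by apply: polyfun_ext (polyfun_const 0) => e; rewrite big_nil.
by apply: polyfun_ext (polyfunD (pF i) IHr) => e; rewrite big_cons.
Qed.

(** Opposites, multiples and powers reduce to products, so constants, coordinates, sums and products
    are the only cases left. *)
Lemma polyfun_ind (K : (seq R -> R) -> Prop) :
  (forall F G, F =1 G -> K F -> K G) ->
  (forall c, K (fun=> c)) -> (forall i, K (fun e => e`_i)) ->
  (forall F G, K F -> K G -> K (fun e => F e + G e)) ->
  (forall F G, K F -> K G -> K (fun e => F e * G e)) ->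
  forall F, polyfun F -> K F.
Proof.
move=> Kext Kc Kn KD KM F [t rt tE]; apply: (Kext _ _ tE).
elim: t rt {tE} => //=.
- by move=> t IHt u IHu /andP[/IHt Kt /IHu Ku]; exact: KD.
- move=> t IHt /IHt Kt; apply: Kext (KM _ _ (Kc (-1)) Kt) => e.
  by rewrite mulN1r.
- move=> t IHt n /IHt Kt; apply: Kext (KM _ _ (Kc n%:R) Kt) => e.
  by rewrite mulr_natl.
- by move=> t IHt u IHu /andP[/IHt Kt /IHu Ku]; exact: KM.
- move=> t IHt n /IHt Kt; elim: n => [|n IHn].
    by apply: Kext (Kc 1) => e; rewrite expr0.
  by apply: Kext (KM _ _ Kt IHn) => e; rewrite exprS.
Qed.

Lemma polyfun_behead F : polyfun F -> polyfun (fun e => F (behead e)).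
Proof.
move: F; apply: polyfun_ind => [F G FG|c|i|F G|F G].
- by apply: polyfun_ext => e; rewrite FG.
- exact: polyfun_const.
- by apply: polyfun_ext (polyfun_nth i.+1) => e; rewrite nth_behead.
- exact: polyfunD.
- exact: polyfunM.
Qed.

Lemma polyfun_horner F :
  polyfun F -> exists q : {poly R}, forall x, F [:: x] = q.[x].
Proof.
move: F; apply: polyfun_ind => [F G FG [q qE]|c|i|F G [q qE] [r rE]|F G [q qE] [r rE]].
- by exists q => x; rewrite -FG.
- by exists c%:P => x; rewrite hornerC.
- case: i => [|i]; first by exists 'X => x; rewrite hornerX.
  by exists 0 => x; rewrite horner0 /= nth_nil.
- by exists (q + r) => x; rewrite hornerD qE rE.
- by exists (q * r) => x; rewrite hornerM qE rE.
Qed.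

Lemma polyfun_bounded F (M : R) : polyfun F ->
  exists B, forall e, (forall i, `|e`_i| <= M) -> `|F e| <= B.
Proof.
move: F; apply: polyfun_ind => [F G FG [B FB]|c|i|F G [B FB] [D GD]|F G [B FB] [D GD]].
- by exists B => e eM; rewrite -FG; exact: FB.
- by exists `|c|.
- by exists M => e; apply.
- exists (B + D) => e eM; apply: le_trans (ler_normD _ _) _.
  by rewrite lerD ?FB ?GD.
- by exists (B * D) => e eM; rewrite normrM ler_pM ?FB ?GD.
Qed.

Lemma polyfun_continuous F e (eps : R) : polyfun F -> 0 < eps ->
  exists2 dlt, 0 < dlt &
    forall e', (forall i, `|e'`_i - e`_i| <= dlt) -> `|F e' - F e| <= eps.
Proof.
move=> pF; move: F pF eps; apply: polyfun_ind.
- move=> F G FG FP eps /FP[d d0 dP]; exists d => // e' /dP.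
  by rewrite !FG.
- by move=> c eps e0; exists 1 => // e' _; rewrite subrr normr0 ltW.
- by move=> i eps e0; exists eps => // e'; apply.
- move=> F G FP GP eps e0; have e2 : 0 < eps / 2 by lra.
  have [d d0 dP] := FP _ e2; have [d' d'0 d'P] := GP _ e2.
  exists (Num.min d d') => [|e' e'P]; first by rewrite lt_min d0.
  have Fe : `|F e' - F e| <= eps / 2.
    by apply: dP => i; rewrite (le_trans (e'P i)) // ge_min lexx.
  have Ge : `|G e' - G e| <= eps / 2.
    by apply: d'P => i; rewrite (le_trans (e'P i)) // ge_min lexx orbT.
  rewrite opprD addrACA [leRHS]splitr.
  by rewrite (le_trans (ler_normD _ _)) // lerD.
- move=> F G FP GP eps e0.
  have F1 : 0 < `|F e| + 1 by rewrite ltr_wpDl.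
  have G1 : 0 < `|G e| + 1 by rewrite ltr_wpDl.
  (* [G e'] will stay within 1 of [G e], hence the bound [|G e| + 1]; the summand 1 also keeps both
     divisors positive. *)
  have eF : 0 < eps / 2 / (`|G e| + 1) by rewrite !divr_gt0.
  have eG : 0 < Num.min 1 (eps / 2 / (`|F e| + 1)).
    by rewrite lt_min ltr01 !divr_gt0.
  have [d d0 dP] := FP _ eF; have [d' d'0 d'P] := GP _ eG.
  exists (Num.min d d') => [|e' e'P]; first by rewrite lt_min d0.
  have Fe : `|F e' - F e| <= eps / 2 / (`|G e| + 1).
    by apply: dP => i; rewrite (le_trans (e'P i)) // ge_min lexx.
  have : `|G e' - G e| <= Num.min 1 (eps / 2 / (`|F e| + 1)).
    by apply: d'P => i; rewrite (le_trans (e'P i)) // ge_min lexx orbT.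
  rewrite le_min => /andP[Ge1 Ge].
  have -> : F e' * G e' - F e * G e = (F e' - F e) * G e' + F e * (G e' - G e).
    by ring.
  rewrite (splitr eps) (le_trans (ler_normD _ _)) // !normrM lerD //.
    move: Fe; rewrite ler_pdivlMr // => /(le_trans _); apply.
    rewrite ler_wpM2l // -[G e'](subrK (G e)) addrC.
    by rewrite (le_trans (ler_normD _ _)) // lerD.
  move: Ge; rewrite ler_pdivlMr // mulrC => /(le_trans _); apply.
  by rewrite ler_wpM2r // lerDl.
Qed.

(** Only environments of length [k] matter, so that a quantifier can bind the next free index
    [k]. *)
Definition definable (k : nat) P :=
  exists f : ord.formula R, forall e, size e = k -> (ord.holds e f <-> P e).

Lemma definable_ext k P Q : (forall e, size e = k -> (P e <-> Q e)) ->
  definable k P -> definable k Q.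
Proof. by move=> PQ [f fP]; exists f => e se; rewrite fP // PQ. Qed.

Lemma definable_le k F G :
  polyfun F -> polyfun G -> definable k (fun e => F e <= G e).
Proof.
by move=> [t _ tE] [u _ uE]; exists (ord.Le t u) => e _; rewrite /= tE uE.
Qed.

Lemma definable_lt k F G :
  polyfun F -> polyfun G -> definable k (fun e => F e < G e).
Proof.
by move=> [t _ tE] [u _ uE]; exists (ord.Lt t u) => e _; rewrite /= tE uE.
Qed.

Lemma definable_and k P Q :
  definable k P -> definable k Q -> definable k (fun e => P e /\ Q e).
Proof.
by move=> [f fP] [g gQ]; exists (ord.And f g) => e se; rewrite /= fP ?gQ.
Qed.

Lemma definable_or k P Q :
  definable k P -> definable k Q -> definable k (fun e => P e \/ Q e).
Proof.
by move=> [f fP] [g gQ]; exists (ord.Or f g) => e se; rewrite /= fP ?gQ.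
Qed.

Lemma set_nth_size e x : set_nth 0 e (size e) x = rcons e x.
Proof. by elim: e => //= y e ->. Qed.

Lemma definable_ex k P :
  definable k.+1 P -> definable k (fun e => exists x, P (rcons e x)).
Proof.
move=> [f fP]; exists (ord.Exists k f) => e se /=.
by split=> -[x Px]; exists x; move: Px; rewrite -se set_nth_size fP // size_rcons se.
Qed.

Lemma definable_not k P : definable k P -> definable k (fun e => ~ P e).
Proof. by move=> [f fP]; exists (ord.Not f) => e se; rewrite /= fP. Qed.

Lemma definable_exists k j P : definable (k + j) P ->
  definable k (fun e => exists2 l, size l = j & P (e ++ l)).
Proof.
elim: j P => [|j IHj] P.
  rewrite addn0; apply: definable_ext => e se; split=> [Pe|].
    by exists [::]; rewrite ?cats0.
  by move=> [l /size0nil->]; rewrite cats0.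
rewrite addnS => /definable_ex/IHj; apply: definable_ext => e se; split.
  by move=> [l sl [x Px]]; exists (rcons l x); rewrite ?size_rcons ?sl -?rcons_cat.
move=> [l]; case/lastP: l => // l x; rewrite size_rcons => -[sl] Px.
by exists l => //; exists x; rewrite rcons_cat.
Qed.

Lemma term_shift (t : GRing.term R) : exists u : GRing.term R,
  forall e, GRing.eval e u = GRing.eval (behead e) t.
Proof.
elim: t => [i|c|c|t [t' tE] u [u' uE]|t [t' tE]|t [t' tE] n|t [t' tE] u [u' uE]
  |t [t' tE]|t [t' tE] n].
- by exists (GRing.Var R i.+1) => e; rewrite /= nth_behead.
- by exists (GRing.Const c).
- by exists (GRing.NatConst R c).
- by exists (GRing.Add t' u') => e; rewrite /= tE uE.
- by exists (GRing.Opp t') => e; rewrite /= tE.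
- by exists (GRing.NatMul t' n) => e; rewrite /= tE.
- by exists (GRing.Mul t' u') => e; rewrite /= tE uE.
- by exists (GRing.Inv t') => e; rewrite /= tE.
- by exists (GRing.Exp t' n) => e; rewrite /= tE.
Qed.

(** Bound indices move along with the free ones, because a quantifier overwrites an entry of the
    environment. The shift makes room for a parameter at the head. *)
Lemma formula_shift (f : ord.formula R) : exists g : ord.formula R,
  forall e, ord.holds e g <-> ord.holds (behead e) f.
Proof.
have bs e i x : behead (set_nth 0 e i.+1 x) = set_nth 0 (behead e) i x.
  by case: e => //; case: i.
elim: f => [b|t u|t u|t u|t|f [f' fE] g [g' gE]|f [f' fE] g [g' gE]
  |f [f' fE] g [g' gE]|f [f' fE]|i f [f' fE]|i f [f' fE]].
- by exists (ord.Bool b).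
- have [t' tE] := term_shift t; have [u' uE] := term_shift u.
  by exists (ord.Equal t' u') => e; rewrite /= tE uE.
- have [t' tE] := term_shift t; have [u' uE] := term_shift u.
  by exists (ord.Lt t' u') => e; rewrite /= tE uE.
- have [t' tE] := term_shift t; have [u' uE] := term_shift u.
  by exists (ord.Le t' u') => e; rewrite /= tE uE.
- by have [t' tE] := term_shift t; exists (ord.Unit t') => e; rewrite /= tE.
- by exists (ord.And f' g') => e; rewrite /= fE gE.
- by exists (ord.Or f' g') => e; rewrite /= fE gE.
- by exists (ord.Implies f' g') => e; rewrite /= fE gE.
- by exists (ord.Not f') => e; rewrite /= fE.
- exists (ord.Exists i.+1 f') => e /=.
  by split=> -[x fx]; exists x; move: fx; rewrite fE bs.
- exists (ord.Forall i.+1 f') => e /=.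
  by split=> fx x; move: (fx x); rewrite fE bs.
Qed.

Lemma definable_behead k P : definable k P -> definable k.+1 (fun e => P (behead e)).
Proof.
move=> [f fP]; have [g gP] := formula_shift f; exists g => e se.
by rewrite gP fP // size_behead se.
Qed.

(** O-minimality in one variable: the truth value can change only at the finitely many points of
    [s]. *)
Definition piecewise_constant (phi : R -> bool) := exists s : seq R,
  forall x y, x <= y -> {in s, forall z, ~~ (x <= z <= y)} -> phi x = phi y.

Lemma piecewise_constant2 (op : bool -> bool -> bool) (phi psi : R -> bool) :
  piecewise_constant phi -> piecewise_constant psi ->
  piecewise_constant (fun x => op (phi x) (psi x)).
Proof.
move=> [s sP] [r rP]; exists (s ++ r) => x y xy xyN; congr (op _ _).
  by apply: sP => // z zs; apply: xyN; rewrite mem_cat zs.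
by apply: rP => // z zs; apply: xyN; rewrite mem_cat zs orbT.
Qed.

(** The breakpoints are the roots of the polynomial; on an interval without roots its sign is
    constant. *)
Lemma piecewise_constant_sg (sig : R -> bool) F : polyfun F ->
  piecewise_constant (fun x => sig (Num.sg (F [:: x]))).
Proof.
move=> /polyfun_horner[q qE]; have [q0|q0] := eqVneq q 0.
  by exists [::] => x y _ _; rewrite !qE q0 !horner0.
exists (rootsR q) => x y xy xyN; rewrite !qE; congr sig.
apply: (@polyrN0_itv _ `[x, y]); rewrite ?in_itv /= ?lexx ?xy //.
move=> z; rewrite in_itv /= => zxy; apply/negP => rz.
have := roots_on_rootsR q0 z; rewrite in_itv rz /= => /esym/xyN.
by rewrite zxy.
Qed.

Lemma piecewise_constant_qf (f : ord.formula R) :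
  ord.qf_form f -> ord.rformula f ->
  piecewise_constant (fun x => ord.qf_eval [:: x] f).
Proof.
(* A comparison depends only on the sign of the difference of its two terms. *)
have atom (t u : GRing.term R) (sig : R -> bool) (op : rel R) :
    GRing.rterm t && GRing.rterm u -> (forall a b, sig (Num.sg (a - b)) = op a b) ->
    piecewise_constant (fun x => op (GRing.eval [:: x] t) (GRing.eval [:: x] u)).
  move=> /andP[rt ru] sigE.
  have pt : polyfun (fun e => GRing.eval e t) by exists t.
  have pu : polyfun (fun e => GRing.eval e u) by exists u.
  have [s sP] := piecewise_constant_sg sig (polyfunB pt pu).
  by exists s => x y xy /(sP x y xy); rewrite !sigE.
elim: f => //=.
- by move=> b _ _; exists [::].
- move=> t u _ rtu; apply: (atom t u (fun a => a == 0) (fun a b => a == b)) => // a b.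
  by rewrite sgr_eq0 subr_eq0.
- move=> t u _ rtu; apply: (atom t u (fun a => a < 0) (fun a b => a < b)) => // a b.
  by rewrite sgr_lt0 subr_lt0.
- move=> t u _ rtu; apply: (atom t u (fun a => a <= 0) (fun a b => a <= b)) => // a b.
  by rewrite sgr_le0 subr_le0.
- move=> f IHf g IHg /andP[qf qg] /andP[rf rg].
  exact: (piecewise_constant2 andb (IHf qf rf) (IHg qg rg)).
- move=> f IHf g IHg /andP[qf qg] /andP[rf rg].
  exact: (piecewise_constant2 orb (IHf qf rf) (IHg qg rg)).
- move=> f IHf g IHg /andP[qf qg] /andP[rf rg].
  exact: (piecewise_constant2 implb (IHf qf rf) (IHg qg rg)).
- move=> f IHf qf rf.
  exact: (piecewise_constant2 (fun a _ => ~~ a) (IHf qf rf) (IHf qf rf)).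
Qed.

Lemma definable_piecewise_constant (A : R -> Prop) :
  definable 1 (fun e => A (head 0 e)) ->
  exists2 phi, piecewise_constant phi & forall x, A x <-> phi x.
Proof.
move=> [f fA]; exists (fun x => rcf_sat [:: x] f); last first.
  by move=> x; rewrite -(fA [:: x]) //; split=> /rcf_satP.
(* [rcf_sat] evaluates the quantifier-free formula produced by elimination. *)
have /andP[qf rf] := ord.quantifier_elim_wf (@wf_QE_wproj R)
  (ord.to_rform_rformula f).
exact: piecewise_constant_qf.
Qed.

(** The downward closure [B] switches once from true to false. The switch is enclosed in a bracket
    without interior breakpoints, and the supremum is one of its ends. *)
Lemma definable_sup (A : R -> Prop) a b :
  definable 1 (fun e => A (head 0 e)) -> A a -> (forall x, A x -> x <= b) ->
  exists2 s, (forall x, A x -> x <= s) &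
    (forall y, y < s -> exists2 x, A x & y < x).
Proof.
move=> dA Aa Ab.
pose B x := exists2 l : seq R, size l = 1%N & A (head 0 l) /\ x <= l`_0.
have dB : definable 1 (fun e => B (head 0 e)).
  have := @definable_exists 1 1 (fun e => A (head 0 (behead e)) /\ e`_0 <= e`_1).
  case/(_ (definable_and (definable_behead dA)
    (definable_le 2 (polyfun_nth 0) (polyfun_nth 1)))) => f fP.
  by exists f => -[|x []] // _; exact: fP.
have BP x : B x <-> exists2 y, A y & x <= y.
  split=> [[l _ []]|[y Ay xy]]; first by exists (head 0 l); rewrite // -nth0.
  by exists [:: y]; split.
have [phi [s sP] phiP] := definable_piecewise_constant dB.
have {}phiP x : reflect (B x) (phi x) by apply: (iffP idP); rewrite phiP.
(* Each breakpoint strictly inside the current bracket, initially from [a] to [b + 1], replaces one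
   of its ends. *)
have [lo [hi [Blo Bhi sN]]] : exists lo hi,
    [/\ phi lo, ~~ phi hi & {in s, forall z, z <= lo \/ hi <= z}].
  elim: s {sP} => [|z s [lo [hi [Blo Bhi sN]]]].
    exists a, (b + 1); split=> //; first by apply/phiP/BP; exists a.
    apply/phiP => /BP[y /Ab yb] /le_trans/(_ yb).
    by rewrite gerDl ler10.
  have [zlo|loz] := leP z lo.
    by exists lo, hi; split=> // w; rewrite inE => /predU1P[->|/sN//]; left.
  have [hiz|zhi] := leP hi z.
    by exists lo, hi; split=> // w; rewrite inE => /predU1P[->|/sN//]; right.
  have [Bz|Bz] := boolP (phi z).
    exists z, hi; split=> // w; rewrite inE => /predU1P[->|/sN[wlo|]]; auto.
    by left; rewrite (le_trans wlo) ?ltW.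
  exists lo, z; split=> // w; rewrite inE => /predU1P[->|/sN[|wlo]]; auto.
  by right; rewrite (le_trans _ wlo) ?ltW.
have Bdown x y : x <= y -> phi y -> phi x.
  move=> xy /phiP/BP[z Az yz]; apply/phiP/BP; exists z => //; exact: le_trans yz.
have lohi : lo < hi by rewrite ltNge; apply: contra Bhi => /Bdown; exact.
have cst x y : lo < x -> x <= y -> y < hi -> phi x = phi y.
  move=> lox xy yhi; apply: sP => // z /sN[zlo|hiz].
    by rewrite negb_and -ltNge (le_lt_trans zlo).
  by rewrite negb_and -!ltNge (lt_le_trans yhi) ?orbT.
(* [phi] is constant inside the bracket, so its value at the midpoint tells which end is the
   supremum. *)
have [Bm|Bm] := boolP (phi ((lo + hi) / 2)).
  exists hi => [x Ax|y yhi].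
    rewrite leNgt; apply: contra Bhi => /ltW hix.
    by apply/phiP/BP; exists x.
  pose w := (Num.max y ((lo + hi) / 2) + hi) / 2.
  have [yw wm whi] : [/\ y < w, (lo + hi) / 2 <= w & w < hi].
    have : Num.max y ((lo + hi) / 2) < hi by rewrite gt_max yhi midf_lt.
    have : y <= Num.max y ((lo + hi) / 2) by rewrite le_max lexx.
    have : (lo + hi) / 2 <= Num.max y ((lo + hi) / 2) by rewrite le_max lexx orbT.
    by rewrite /w; move: (Num.max _ _) => u; split; lra.
  move: Bm; rewrite (cst _ w) // ?midf_lt // => /phiP/BP[x Ax wx].
  by exists x => //; exact: lt_le_trans wx.
exists lo => [x Ax|y ylo]; last first.
  by move/phiP/BP: Blo => [x Ax lox]; exists x => //; exact: lt_le_trans lox.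
rewrite leNgt; apply: contra Bm => lox.
have Bx : phi x by apply/phiP/BP; exists x.
have [xm|] := leP ((lo + hi) / 2) x; first exact: Bdown Bx.
by move=> xm; rewrite -(cst x) ?ltW ?midf_lt.
Qed.

(** Excluded middle for definable predicates, obtained by deciding the formula. *)
Lemma definable_dec k P e : definable k P -> size e = k -> P e \/ ~ P e.
Proof.
by move=> [f fP] se; have := fP e se; case: (rcf_satP e f) => h; tauto.
Qed.

Lemma definable_normB_le k F G H :
  polyfun F -> polyfun G -> polyfun H -> definable k (fun e => `|F e - G e| <= H e).
Proof.
move=> pF pG pH; have pFG := polyfunB pF pG.
apply: definable_ext
  (definable_and (definable_le k (polyfunN pH) pFG) (definable_le k pFG pH)).
by move=> e _; rewrite ler_norml; split=> [[-> ->]|/andP[]].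
Qed.

(** * Compactness through nested definable families *)

Section Families.
Variable k : nat.
Implicit Type K : R -> seq R -> Prop.

(** A definable filter base, shrinking as the parameter decreases to 0. It takes the place of a
    sequence in the compactness argument. *)
Definition nested_family K := [/\
  definable k.+1 (fun e => K (head 0 e) (behead e)),
  forall s t l, 0 < s -> s <= t -> K s l -> K t l &
  forall t, 0 < t -> exists2 l, size l = k & K t l].

(* [x] is the limit inferior of [F] along the family. *)
Lemma nested_family_limit K F B : nested_family K -> polyfun F ->
  (forall t l, size l = k -> K t l -> `|F l| <= B) ->
  exists x, [/\ nested_family (fun t l => K t l /\ `|F l - x| <= t) &
    forall y, y < x -> exists2 t, 0 < t & forall l, size l = k -> K t l -> y < F l].
Proof.
move=> [dK mK nK] pF FB.
pose N x t := exists2 l, size l = k & K t l /\ F l <= x.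
have dN : definable 2 (fun e => N e`_0 e`_1).
  have pFb := polyfun_behead (polyfun_behead pF).
  have [f fP] := @definable_exists 2 k _
    (definable_and (definable_behead dK) (definable_le k.+2 pFb (polyfun_nth 0))).
  by exists f => -[|x [|t []]] // _; exact: fP.
have decN x t : N x t \/ ~ N x t by exact: (@definable_dec 2 _ [:: x; t] dN).
(* [x] is in [A] when [F] exceeds [x] throughout some [K t]; the limit inferior is the supremum of
   [A]. *)
pose A x := exists2 t, 0 < t & ~ N x t.
have dA : definable 1 (fun e => A (head 0 e)).
  have [f fP] := definable_ex (definable_and
    (definable_lt 2 (polyfun_const 0) (polyfun_nth 1)) (definable_not dN)).
  exists f => -[|x []] // _; rewrite fP //.
  by split=> [[t [t0 nN]]|[t t0 nN]]; exists t.
have [|x [t t0 nN]|x xA Ax] := @definable_sup A (- B - 1) B dA.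
- exists 1 => // -[l sl [Kl Fl]]; have := FB _ _ sl Kl.
  by rewrite ler_norml => /andP[lB _]; have := le_trans lB Fl; lra.
- have [l sl Kl] := nK t t0; rewrite leNgt; apply/negP => Bx; case: nN.
  exists l => //; split=> //; apply: le_trans (ltW Bx).
  exact: le_trans (ler_norm _) (FB _ _ sl Kl).
exists x; split=> [|y /Ax[x' [t t0 nN] yx']]; last first.
  exists t => // l sl Kl; rewrite ltNge; apply/negP => Fly; case: nN.
  by exists l; rewrite ?(le_trans Fly) ?ltW.
split.
- apply: definable_and => //.
  exact: definable_ext (definable_normB_le k.+1 (polyfun_behead pF)
    (polyfun_const x) (polyfun_nth 0)).
- by move=> s t l s0 st [/(mK _ _ _ s0 st) Kt /le_trans ->].
(* Some [K t'] has [F > x - t] throughout, while [x + t] is outside [A], so every member of the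
   family has a point with [F <= x + t]. *)
move=> t t0; have [|x' [t' t'0 nN] xx'] := Ax (x - t); first by lra.
have s0 : 0 < Num.min t t' by rewrite lt_min t0.
have [[l sl [Kl Fl]]|nN'] := decN (x + t) (Num.min t t'); last first.
  have /xA : A (x + t) by exists (Num.min t t').
  by lra.
exists l => //; split; first by apply: mK Kl; rewrite // ge_min lexx.
have Kl' : K t' l by apply: mK Kl; rewrite // ge_min lexx orbT.
have : x' < F l.
  by rewrite ltNge; apply/negP => Fx'; case: nN; exists l.
by rewrite ler_norml; lra.
Qed.

(** Bolzano-Weierstrass, one coordinate at a time: each limit inferior cuts out a smaller nested
    family along which that coordinate converges. *)
Lemma nested_family_limits K M (js : seq nat) : nested_family K ->
  (forall t l, size l = k -> K t l -> forall i, `|l`_i| <= M) ->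
  exists c : nat -> R, forall t, 0 < t -> exists2 l, size l = k &
    K t l /\ {in js, forall j, `|l`_j - c j| <= t}.
Proof.
elim: js K => [|j js IHjs] K fK KM.
  by exists (fun=> 0) => t /(let: And3 _ _ nK := fK in nK)[l sl Kl]; exists l.
have [|x [fK' _]] := nested_family_limit (F := fun e => e`_j) (B := M) fK (polyfun_nth j).
  by move=> t l sl Kl; exact: KM Kl j.
have [|c cP] := IHjs _ fK'; first by move=> t l sl [Kl _]; exact: KM Kl.
exists (fun i => if i == j then x else c i) => t /cP[l sl [[Kl lx] lc]].
exists l => //; split=> // i; rewrite inE.
have [->|_] //= := eqVneq i j; exact: lc.
Qed.
End Families.

Definition closed_set k P := forall e, size e = k ->
  (forall t, 0 < t -> exists2 l, size l = k & P l /\ forall i, `|l`_i - e`_i| <= t) ->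
  P e.

(** In the constant family [P], points with [F] close to its limit inferior [x] accumulate at some
    [e]; closedness puts [e] in [P] and continuity gives [F e <= x]. *)
Theorem polyfun_attains_min k P F M e0 :
  definable k P -> closed_set k P ->
  (forall l, size l = k -> P l -> forall i, `|l`_i| <= M) ->
  size e0 = k -> P e0 -> polyfun F ->
  exists e, [/\ size e = k, P e & forall l, size l = k -> P l -> F e <= F l].
Proof.
move=> dP cP PM se0 Pe0 pF.
have fP : nested_family k (fun _ => P).
  by split=> [||t _]; [exact: definable_behead | | exists e0].
have [B FB] := polyfun_bounded M pF.
have [|x [fP' xmin]] := nested_family_limit (B := B) fP pF.
  by move=> _ l sl Pl; apply: FB; exact: PM.
have [|c cE] := nested_family_limits (M := M) (iota 0 k) fP'.
  by move=> t l sl [Pl _]; exact: PM.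
pose e := mkseq c k.
have near t : 0 < t -> exists2 l, size l = k &
    [/\ P l, `|F l - x| <= t & forall i, `|l`_i - e`_i| <= t].
  move=> t0; have [l sl [[Pl Fl] lc]] := cE t t0; exists l => //; split=> // i.
  have [ik|ki] := ltnP i k; first by rewrite nth_mkseq ?lc // mem_iota.
  by rewrite !nth_default ?size_mkseq ?sl // subrr normr0 ltW.
exists e; split; rewrite ?size_mkseq //.
  apply: cP; rewrite ?size_mkseq // => t /near[l sl [Pl _ le]].
  by exists l.
move=> l sl Pl; apply: (@le_trans _ _ x); last first.
  by rewrite leNgt; apply/negP => /xmin[t t0 /(_ l sl Pl)]; rewrite ltxx.
rewrite leNgt; apply/negP => xF.
(* A point near [e] would have [F] within a third of the gap of both [x] and [F e], which is
   impossible. *)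
have eps0 : 0 < (F e - x) / 3 by rewrite divr_gt0 ?subr_gt0.
have [d d0 dF] := polyfun_continuous e pF eps0.
have [|l' sl' [Pl' Fl' le]] := near (Num.min d ((F e - x) / 3)).
  by rewrite lt_min d0.
have : `|F l' - F e| <= (F e - x) / 3.
  by apply: dF => i; rewrite (le_trans (le i)) // ge_min lexx.
move: Fl'; rewrite le_min => /andP[_].
by rewrite !ler_norml; lra.
Qed.

Lemma polyfun_ge0_closed k F : polyfun F -> closed_set k (fun e => 0 <= F e).
Proof.
move=> pF e se eP; rewrite leNgt; apply/negP => F0.
have eps0 : 0 < - F e / 2 by lra.
have [d d0 dF] := polyfun_continuous e pF eps0.
have [l sl [Fl /dF]] := eP d d0.
by rewrite ler_norml; lra.
Qed.

Lemma closed_set_and k P Q :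
  closed_set k P -> closed_set k Q -> closed_set k (fun e => P e /\ Q e).
Proof.
move=> cP cQ e se eP; split; [apply: cP | apply: cQ] => // t /eP[l sl [[]]];
  by exists l.
Qed.
End Definable.

(** * The S-lemma for three Hermitian forms *)

(** [tau] must lie above the slopes [f z / g z] where [g z < 0] and below those where [g z > 0]. The
    second hypothesis says that the former never exceed the latter, so [tau] is the supremum of 0
    and the former; [z0] bounds it. *)
Lemma separating_multiplier (R : rcfType) (Z : Type) (K : Z -> Prop) (f g : Z -> R) z0 :
  definable 1 (fun e => exists z, [/\ K z, g z < 0 & f z <= head 0 e * g z]) ->
  (forall x y, K x -> K y -> 0 < g x -> g y < 0 -> 0 <= - g y * f x + g x * f y) ->
  K z0 -> 0 < g z0 -> (forall z, K z -> 0 <= g z -> 0 <= f z) ->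
  exists2 tau, 0 <= tau & forall z, K z -> tau * g z <= f z.
Proof.
move=> dA comb Kz0 gz0 Kpos.
(* For [g z < 0] the last inequality means [x <= f z / g z]; without the division it is
   polynomial. *)
pose A x := x <= 0 \/ exists z, [/\ K z, g z < 0 & f z <= x * g z].
have A_le z x : K z -> 0 < g z -> A x -> x <= f z / g z.
  move=> Kz gz [x0|[y [Ky gy fy]]].
    by rewrite (le_trans x0) // divr_ge0 ?Kpos // ltW.
  rewrite ler_pdivlMr // -subr_ge0 -(pmulr_rge0 _ (_ : 0 < - g y)) ?oppr_gt0 //.
  apply: le_trans (comb _ _ Kz Ky gz gy) _.
  by move: (ler_wpM2l (ltW gz) fy); lra.
have [|||tau tauA Atau] := @definable_sup R A 0 (f z0 / g z0).
- have dle := definable_le 1 (polyfun_nth R 0) (polyfun_const 0).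
  by apply: definable_ext (definable_or dle dA) => -[|x []].
- by left.
- by move=> x; exact: A_le.
exists tau => [|z Kz]; first by apply: tauA; left.
have [gz|gz|gz] := ltrgt0P (g z).
- rewrite -ler_pdivlMr // leNgt; apply/negP => /Atau[x Ax].
  by rewrite ltNge A_le.
- rewrite -ler_ndivrMr //; apply: tauA; right; exists z; split=> //.
  by rewrite divfK // ltr0_neq0.
- by rewrite gz mulr0 Kpos ?gz.
Qed.

(* The ray [1 + s D] through a Hermitian 2x2 matrix [D = (p, q; q^*, r)], with
   [q = q1 + i q2], leaves the semidefinite cone at a matrix of rank at most one. *)
Lemma rank_one_on_ray (R : rcfType) (p r q1 q2 : R) :
  [|| p != 0, r != 0, q1 != 0 | q2 != 0] ->
  exists s a b1 b2, [/\ a ^+ 2 = 1 + s * p, b1 ^+ 2 + b2 ^+ 2 = 1 + s * r,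
    a * b1 = s * q1 & a * b2 = s * q2].
Proof.
(* Changing the signs of the matrix and of [s] makes the trace nonnegative. *)
wlog pr0 : p r q1 q2 / 0 <= p + r => [hwlog|nz].
  have [/hwlog|pr0] := leP 0 (p + r); first exact.
  rewrite -(oppr_eq0 p) -(oppr_eq0 r) -(oppr_eq0 q1) -(oppr_eq0 q2) => /hwlog.
  case=> [|s [a [b1 [b2 [e1 e2 e3 e4]]]]]; first by lra.
  by exists (- s), a, b1, b2; rewrite !mulNr -!mulrN.
(* The gap between the two eigenvalues. The larger eigenvalue [lam] is positive, and the
   semidefinite cone is left at [s = - lam^-1]. *)
pose D := Num.sqrt ((p - r) ^+ 2 + 4 * (q1 ^+ 2 + q2 ^+ 2)).
have D0 : 0 <= D by exact: sqrtr_ge0.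
have D2 : D ^+ 2 = (p - r) ^+ 2 + 4 * (q1 ^+ 2 + q2 ^+ 2).
  rewrite sqr_sqrtr //; have := sqr_ge0 (p - r).
  by have := sqr_ge0 q1; have := sqr_ge0 q2; lra.
have prD : `|p - r| <= D.
  rewrite -(@ler_pXn2r _ 2) ?nnegrE //; rewrite D2 real_normK ?num_real //.
  by have := sqr_ge0 q1; have := sqr_ge0 q2; lra.
pose lam := (p + r + D) / 2.
have lam0 : 0 < lam.
  rewrite divr_gt0 // lt_neqAle addr_ge0 // andbT eq_sym paddr_eq0 //.
  apply: contraL nz => /andP[/eqP pr /eqP D_0].
  have [pr_ge0 q1_ge0 q2_ge0] := And3 (sqr_ge0 (p - r)) (sqr_ge0 q1) (sqr_ge0 q2).
  have q1_0 : q1 ^+ 2 = 0 by move: D2; rewrite D_0 expr0n /=; lra.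
  have q2_0 : q2 ^+ 2 = 0 by move: D2; rewrite D_0 expr0n /=; lra.
  move: prD; rewrite D_0 normr_le0 subr_eq0 => /eqP p_r.
  move/eqP: q1_0; move/eqP: q2_0; rewrite !sqrf_eq0 => /eqP-> /eqP->.
  have -> : p = 0 by lra.
  have -> : r = 0 by lra.
  by rewrite eqxx.
have A0 : 0 <= 1 - lam^-1 * p.
  rewrite subr_ge0 mulrC ler_pdivrMr // mul1r /lam.
  by move: prD; rewrite ler_norml; lra.
have B0 : 0 <= 1 - lam^-1 * r.
  rewrite subr_ge0 mulrC ler_pdivrMr // mul1r /lam.
  by move: prD; rewrite ler_norml; lra.
have lamn0 : lam != 0 by rewrite gt_eqF.
(* The determinant vanishes at this [s], by the characteristic equation of [lam]. *)
have AB : (1 - lam^-1 * p) * (1 - lam^-1 * r) = lam^-1 ^+ 2 * (q1 ^+ 2 + q2 ^+ 2).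
  have -> : q1 ^+ 2 + q2 ^+ 2 = (D ^+ 2 - (p - r) ^+ 2) / 4 by rewrite D2; field.
  have -> : D = 2 * lam - p - r by rewrite /lam; field.
  by field.
(* If the first diagonal entry vanishes, so does the off-diagonal one and [a = 0] serves; otherwise
   [a] is its square root and [b1], [b2] follow by division. *)
exists (- lam^-1); have [A_0|A_n0] := eqVneq (1 - lam^-1 * p) 0.
  have /eqP := AB; rewrite A_0 mul0r eq_sym mulf_eq0 expf_eq0 invr_eq0 (negPf lamn0) /=.
  rewrite paddr_eq0 ?sqr_ge0 // !sqrf_eq0 => /andP[/eqP-> /eqP->].
  exists 0, (Num.sqrt (1 - lam^-1 * r)), 0.
  split; rewrite ?mulNr ?A_0 ?expr0n ?mul0r ?mulr0 ?oppr0 //.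
  by rewrite addr0 sqr_sqrtr.
pose a := Num.sqrt (1 - lam^-1 * p).
have a2 : a ^+ 2 = 1 - lam^-1 * p by rewrite sqr_sqrtr.
have a0 : a != 0 by rewrite sqrtr_eq0 -ltNge lt_neqAle eq_sym A_n0.
exists a, (- lam^-1 * q1 / a), (- lam^-1 * q2 / a); split.
- by rewrite a2 mulNr.
- rewrite !expr_div_n a2 -mulrDl !exprMn sqrrN -mulrDr -AB mulrC mulKf //.
  by rewrite mulNr.
- by rewrite mulrC divfK.
- by rewrite mulrC divfK.
Qed.

(** * Joint range of Hermitian forms *)

Section Forms.
Variable C : numClosedFieldType.
Local Notation R := (realpart C).

Definition reR (z : C) : R := RealPart (Creal_Re z).
Definition imR (z : C) : R := RealPart (Creal_Im z).

Lemma reRD z w : reR (z + w) = reR z + reR w.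
Proof. by apply/val_inj; rewrite /= raddfD. Qed.

Lemma reRM (a : R) z : reR (rp_val a * z) = a * reR z.
Proof. by apply/val_inj; rewrite /= ReMl ?rp_valP. Qed.

Section Dimension.
Variable N : nat.
Implicit Types (F : 'M[C]_N) (z w : 'cV[C]_N).

(** Taking the real part puts the values in the ordered field [R] for every matrix; on Hermitian
    matrices it changes nothing, by [formE]. *)
Definition rform F z : R := reR ((ctr z *m F *m z) 0 0).

Lemma ctrD (m n : nat) (A B : 'M[C]_(m, n)) : ctr (A + B) = ctr A + ctr B.
Proof. by rewrite /ctr linearD /= map_mxD. Qed.

Lemma ctrZ (m n : nat) c (A : 'M[C]_(m, n)) : ctr (c *: A) = c^* *: ctr A.
Proof. by rewrite /ctr linearZ /= map_mxZ. Qed.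

(** The value is linear in the coordinates [a^2], [b1^2 + b2^2], [a b1], [a b2] of a rank-one
    Hermitian matrix, whose free phase is fixed by a real [a]. *)
Lemma rform_comb F z w : exists c d : R, forall a b1 b2 : R,
  rform F (rp_val a *: z + (rp_val b1 + 'i * rp_val b2) *: w) =
  a ^+ 2 * rform F z + (b1 ^+ 2 + b2 ^+ 2) * rform F w + a * b1 * c + a * b2 * d.
Proof.
pose X := (ctr z *m F *m w) 0 0; pose Y := (ctr w *m F *m z) 0 0.
exists (reR (X + Y)), (reR ('i * (X - Y))) => a b1 b2.
rewrite -!reRM -!reRD /rform; congr reR.
rewrite ctrD !ctrZ !mulmxDl !mulmxDr -!scalemxAl -!scalemxAr.
rewrite /X /Y !mxE conj_Creal ?rp_valP // conjC_rect ?rp_valP //.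
rewrite !rmorphM !rmorphD !rmorphM /=.
have := sqrCi C; move: ('i) => i i2.
ring: i2.
Qed.

Lemma rformZ (a : R) F z : rform F (rp_val a *: z) = a ^+ 2 * rform F z.
Proof.
have [c [d]] := rform_comb F z 0; move/(_ a 0 0).
by rewrite mulr0 addr0 scale0r addr0 => ->; ring.
Qed.

(* The forms impose three linear equations on the four real coordinates of a
   Hermitian 2x2 matrix [D], so on the span of [z] and [w] the sum of the two
   rank-one matrices can be moved along a ray without changing the values of the
   forms, until it has rank one. *)
Lemma joint_range_add (F : 'I_3 -> 'M[C]_N) z w :
  exists u, forall i, rform (F i) u = rform (F i) z + rform (F i) w.
Proof.
have [c] := fin_all_exists (fun i => rform_comb (F i) z w).
move=> /fin_all_exists[d combE].
(* Four coordinates against three forms: the left kernel holds a nonzero direction [v] along which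
   no form changes. *)
pose W : 'M[R]_(4, 3) := \matrix_(j, i)
  [:: rform (F i) z; rform (F i) w; c i; d i]`_j.
have /rowV0Pn[v /sub_kermxP vW v0] : kermx W != 0.
  by rewrite -mxrank_eq0 mxrank_ker -lt0n subn_gt0 (leq_ltn_trans (rank_leq_col W)).
have vE i : v 0 0 * rform (F i) z + v 0 1 * rform (F i) w
    + v 0 2 * c i + v 0 3 * d i = 0.
  have /matrixP/(_ 0 i) := vW; rewrite !mxE !big_ord_recl big_ord0 !mxE /=.
  rewrite addr0 !addrA => <-.
  by congr (_ + _ + _ + _); congr (v _ _ * _); apply/val_inj.
have [|s [a [b1 [b2 [e1 e2 e3 e4]]]]] :=
    @rank_one_on_ray _ (v 0 0) (v 0 1) (v 0 2) (v 0 3).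
  apply: contraNT v0; rewrite !negb_or !negbK => /and4P[/eqP v_0 /eqP v_1 /eqP v_2 /eqP v_3].
  apply/eqP/rowP => j; rewrite mxE.
  have vj (h : 'I_4) : v 0 h = 0 -> j = h :> nat -> v 0 j = 0 by move=> vh /val_inj->.
  case: j vj => -[|[|[|[|//]]]] lt_j vj.
  - exact: vj v_0 _.
  - exact: vj v_1 _.
  - exact: vj v_2 _.
  - exact: vj v_3 _.
exists (rp_val a *: z + (rp_val b1 + 'i * rp_val b2) *: w) => i.
rewrite combE e1 e2 e3 e4; have := vE i.
by move/(congr1 ( *%R s)); lra.
Qed.

Lemma joint_range_cone (F : 'I_3 -> 'M[C]_N) z w (a b : R) : 0 <= a -> 0 <= b ->
  exists u, forall i, rform (F i) u = a * rform (F i) z + b * rform (F i) w.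
Proof.
move=> a0 b0.
have [u uE] := joint_range_add F (rp_val (Num.sqrt a) *: z) (rp_val (Num.sqrt b) *: w).
by exists u => i; rewrite uE !rformZ !sqr_sqrtr.
Qed.

(** Real coordinates of a complex vector, real parts first, turn statements about vectors into
    first-order statements over [R]. *)
Definition decode (l : seq R) : 'cV[C]_N :=
  \col_i (rp_val l`_i + 'i * rp_val l`_(N + i)).

Definition encode z : seq R :=
  [seq reR (z i 0) | i <- enum 'I_N] ++ [seq imR (z i 0) | i <- enum 'I_N].

Lemma size_encode z : size (encode z) = (N + N)%N.
Proof. by rewrite size_cat 2!size_map size_enum_ord. Qed.

Lemma encode_re z (i : 'I_N) : (encode z)`_i = reR (z i 0).
Proof.
by rewrite nth_cat size_map size_enum_ord ltn_ord (nth_map i) ?size_enum_ord // nth_ord_enum.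
Qed.

Lemma encode_im z (i : 'I_N) : (encode z)`_(N + i) = imR (z i 0).
Proof.
rewrite nth_cat size_map size_enum_ord ltnNge leq_addr /= addKn.
by rewrite (nth_map i) ?size_enum_ord // nth_ord_enum.
Qed.

Lemma encodeK z : decode (encode z) = z.
Proof. by apply/colP => i; rewrite mxE encode_re encode_im -Crect. Qed.

Definition cpolyfun (F : seq R -> C) :=
  polyfun (fun e => reR (F e)) /\ polyfun (fun e => imR (F e)).

Lemma cpolyfunM (F G : seq R -> C) :
  cpolyfun F -> cpolyfun G -> cpolyfun (fun e => F e * G e).
Proof.
move=> [Fr Fi] [Gr Gi]; split.
  apply: polyfun_ext (polyfunB (polyfunM Fr Gr) (polyfunM Fi Gi)) => e.
  by apply/val_inj; rewrite /= ReM.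
apply: polyfun_ext (polyfunD (polyfunM Fr Gi) (polyfunM Fi Gr)) => e.
by apply/val_inj; rewrite /= ImM [X in _ = _ + X]mulrC.
Qed.

Lemma cpolyfun_const c : cpolyfun (fun=> c).
Proof. by split; exact: polyfun_const. Qed.

Lemma cpolyfun_sum (I : Type) (r : seq I) (F : I -> seq R -> C) :
  (forall i, cpolyfun (F i)) -> cpolyfun (fun e => \sum_(i <- r) F i e).
Proof.
move=> pF; split.
  apply: polyfun_ext (polyfun_sum r (fun i => (pF i).1)) => e.
  by apply/val_inj; rewrite /= !raddf_sum.
apply: polyfun_ext (polyfun_sum r (fun i => (pF i).2)) => e.
by apply/val_inj; rewrite /= !raddf_sum.
Qed.

Lemma cpolyfun_decode i : cpolyfun (fun e => decode e i 0).
Proof.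
split; [apply: polyfun_ext (polyfun_nth R i) | apply: polyfun_ext (polyfun_nth R (N + i))];
  by move=> e; apply/val_inj; rewrite /= mxE ?Re_rect ?Im_rect ?rp_valP.
Qed.

Lemma cpolyfun_conj (F : seq R -> C) : cpolyfun F -> cpolyfun (fun e => (F e)^*).
Proof.
move=> [Fr Fi]; split.
  by apply: polyfun_ext Fr => e; apply/val_inj; rewrite /= Re_conj.
by apply: polyfun_ext (polyfunN Fi) => e; apply/val_inj; rewrite /= Im_conj.
Qed.

Lemma polyfun_rform F : polyfun (fun e => rform F (decode e)).
Proof.
suff [] : cpolyfun (fun e => (ctr (decode e) *m F *m decode e) 0 0) by [].
have [pre pim] : cpolyfun (fun e =>
    \sum_j (\sum_i (decode e i 0)^* * F i j) * decode e j 0).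
  apply: cpolyfun_sum => j; apply: cpolyfunM (cpolyfun_decode j).
  apply: cpolyfun_sum => i; apply: cpolyfunM (cpolyfun_const _).
  exact/cpolyfun_conj/cpolyfun_decode.
have eE e : \sum_j (\sum_i (decode e i 0)^* * F i j) * decode e j 0 =
    (ctr (decode e) *m F *m decode e) 0 0.
  rewrite [RHS]mxE; apply: eq_bigr => j _; congr (_ * _).
  by rewrite [RHS]mxE; apply: eq_bigr => i _; rewrite !mxE.
by split; [apply: polyfun_ext pre | apply: polyfun_ext pim] => e; rewrite eE.
Qed.

(** [z0] is a Slater point for both constraints. The first multiplier is found on the set [F2 >= 0],
    the second for [F0 - t1 F1] on the whole space. *)
Theorem S_lemma (F0 F1 F2 : 'M[C]_N) z0 :
  0 < rform F1 z0 -> 0 < rform F2 z0 ->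
  (forall z, 0 <= rform F1 z -> 0 <= rform F2 z -> 0 <= rform F0 z) ->
  exists t1 t2 : R, [/\ 0 <= t1, 0 <= t2 &
    forall z, t1 * rform F1 z + t2 * rform F2 z <= rform F0 z].
Proof.
move=> F1z0 F2z0 F0pos.
pose F (i : 'I_3) := nth F0 [:: F0; F1; F2] i.
have cone z w (a b : R) : 0 <= a -> 0 <= b -> exists u,
    [/\ rform F0 u = a * rform F0 z + b * rform F0 w,
      rform F1 u = a * rform F1 z + b * rform F1 w &
      rform F2 u = a * rform F2 z + b * rform F2 w].
  move=> a0 b0; have [u uE] := joint_range_cone F z w a0 b0.
  by exists u; split; [exact: (uE 0) | exact: (uE 1) | exact: (uE 2)].
have dec (K : 'cV[C]_N -> Prop) f g : 
    definable (1 + (N + N)) (fun e => K (decode (behead e))) ->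
    polyfun (fun e => f (decode e)) -> polyfun (fun e => g (decode e)) ->
    definable 1 (fun e : seq R => exists z, [/\ K z, g z < 0 & f z <= head 0 e * g z]).
  move=> dK /polyfun_behead pf /polyfun_behead pg.
  have [h hP] := definable_exists (definable_and dK (definable_and
    (definable_lt _ pg (polyfun_const 0))
    (definable_le _ pf (polyfunM (polyfun_nth R 0) pg)))).
  exists h => -[|x []] // _; rewrite hP //=.
  split=> [[l _ [Kl [gl fl]]]|[z [Kz gz fz]]]; first by exists (decode l).
  by exists (encode z); rewrite ?size_encode ?encodeK.
have [||t1 t10 t1P] := @separating_multiplier _ _ (fun z => 0 <= rform F2 z)
    (rform F0) (rform F1) z0 _ _ (ltW F2z0) F1z0 (fun z F2z F1z => F0pos z F1z F2z).
- apply: dec; [|exact: polyfun_rform..].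
  exact: definable_le (polyfun_const 0) (polyfun_behead (polyfun_rform F2)).
- move=> x y F2x F2y F1x F1y.
  (* These weights make [F1] vanish at [u] and keep [F2] nonnegative there. *)
  have [||u [u0 u1 u2]] := @cone x y (- rform F1 y) (rform F1 x); [lra | exact: ltW | ].
  by rewrite -u0 F0pos // ?u1 ?u2; nra.
have [|||t2 t20 t2P] := @separating_multiplier _ _ (fun=> true)
    (fun z => rform F0 z - t1 * rform F1 z) (rform F2) z0 _ _ isT F2z0.
- apply: dec; last exact: polyfun_rform.
    by exists (ord.Bool true).
  by apply: polyfunB; [|apply: polyfunM (polyfun_const t1) _]; exact: polyfun_rform.
- move=> x y _ _ F2x F2y.
  (* Here [F2] vanishes at [u], so the inequality for [t1] applies. *)
  have [||u [u0 u1 u2]] := @cone x y (- rform F2 y) (rform F2 x); [lra | exact: ltW | ].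
  have /t1P : 0 <= rform F2 u by rewrite u2; lra.
  by rewrite u0 u1; lra.
- by move=> z _ F2z; rewrite subr_ge0 t1P.
by exists t1, t2; split=> // z; have := t2P z isT; lra.
Qed.
End Dimension.
End Forms.

(** * The structured regret *)

Section ConjugateTranspose.
Variable C : numClosedFieldType.

Lemma ctrK (m n : nat) (A : 'M[C]_(m, n)) : ctr (ctr A) = A.
Proof. by apply/matrixP => i j; rewrite !mxE conjCK. Qed.

Lemma ctrN (m n : nat) (A : 'M[C]_(m, n)) : ctr (- A) = - ctr A.
Proof. by rewrite /ctr linearN /= map_mxN. Qed.

Lemma ctr0 (m n : nat) : ctr (0 : 'M[C]_(m, n)) = 0.
Proof. by rewrite /ctr trmx0 map_mx0. Qed.

Lemma ctrM (m n k : nat) (A : 'M[C]_(m, n)) (B : 'M[C]_(n, k)) :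
  ctr (A *m B) = ctr B *m ctr A.
Proof. by rewrite /ctr trmx_mul map_mxM. Qed.

Lemma ctr_scalar (n : nat) (c : C) : c \is Num.real -> ctr (c%:M : 'M_n) = c%:M.
Proof. by move=> cR; rewrite /ctr tr_scalar_mx map_scalar_mx /= conj_Creal. Qed.

Lemma ctr_col_mx (m n k : nat) (A : 'M[C]_(m, k)) (B : 'M[C]_(n, k)) :
  ctr (col_mx A B) = row_mx (ctr A) (ctr B).
Proof. by rewrite /ctr tr_col_mx map_row_mx. Qed.

Lemma ctr_row_mx (m n k : nat) (A : 'M[C]_(k, m)) (B : 'M[C]_(k, n)) :
  ctr (row_mx A B) = col_mx (ctr A) (ctr B).
Proof. by rewrite /ctr tr_row_mx map_col_mx. Qed.

Lemma ctr_block_mx (m n k l : nat) (A : 'M[C]_(m, k)) B D (E : 'M[C]_(n, l)) :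
  ctr (block_mx A B D E) = block_mx (ctr A) (ctr D) (ctr B) (ctr E).
Proof. by rewrite /ctr tr_block_mx map_block_mx. Qed.

Definition form (n : nat) (F : 'M[C]_n) (z : 'cV[C]_n) : C :=
  (ctr z *m F *m z) 0 0.

Definition nsq (n : nat) (z : 'cV[C]_n) : C := (ctr z *m z) 0 0.

Lemma formE (n : nat) (F : 'M[C]_n) z : ctr F = F -> rp_val (rform F z) = form F z.
Proof.
move=> hF; apply/Creal_ReP/CrealP.
have -> : (form F z)^* = (ctr (ctr z *m F *m z)) 0 0 by rewrite [RHS]mxE [in RHS]mxE.
by rewrite !ctrM ctrK hF mulmxA.
Qed.

Lemma rform_ge0 (n : nat) (F : 'M[C]_n) z : ctr F = F -> (0 <= rform F z) = (0 <= form F z).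
Proof. by move/formE <-. Qed.

Lemma formZ (n : nat) (F : 'M[C]_n) c z : form F (c *: z) = `|c| ^+ 2 * form F z.
Proof.
by rewrite /form ctrZ -scalemxAr -!scalemxAl scalerA mxE normCK.
Qed.

Lemma formD (n : nat) (F G : 'M[C]_n) z : form (F + G) z = form F z + form G z.
Proof. by rewrite /form mulmxDr mulmxDl mxE. Qed.

Lemma formN (n : nat) (F : 'M[C]_n) z : form (- F) z = - form F z.
Proof. by rewrite /form mulmxN mulNmx mxE. Qed.

Lemma nsqE (n : nat) (z : 'cV[C]_n) : nsq z = \sum_i `|z i 0| ^+ 2.
Proof.
by rewrite /nsq mxE; apply: eq_bigr => i _; rewrite !mxE normCK mulrC.
Qed.

Lemma nsq_ge0 (n : nat) (z : 'cV[C]_n) : 0 <= nsq z.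
Proof. by rewrite nsqE sumr_ge0 // => i _; rewrite exprn_ge0. Qed.

Lemma nsq_le0 (n : nat) (z : 'cV[C]_n) : nsq z <= 0 -> z = 0.
Proof.
move=> z0; have /eqP : nsq z = 0 by apply/le_anti; rewrite z0 nsq_ge0.
rewrite nsqE psumr_eq0 => [/allP zi0|i _]; last by rewrite exprn_ge0.
apply/colP => i; have := zi0 i (mem_index_enum i).
by rewrite expf_eq0 normr_eq0 mxE /= => /eqP.
Qed.

Lemma nsqZ (n : nat) c (z : 'cV[C]_n) : nsq (c *: z) = `|c| ^+ 2 * nsq z.
Proof. by rewrite /nsq ctrZ -scalemxAr -scalemxAl scalerA mxE normCK. Qed.

Lemma decode_bounded (n : nat) (l : seq (realpart C)) M : size l = (n + n)%N -> 0 <= M ->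
  nsq (decode n l) <= rp_val (M ^+ 2) -> forall i, `|l`_i| <= M.
Proof.
move=> sl M0 lM.
have entry (j : 'I_n) : l`_j ^+ 2 + l`_(n + j) ^+ 2 <= M ^+ 2.
  have : `|decode n l j 0| ^+ 2 <= rp_val (M ^+ 2).
    apply: le_trans lM; rewrite nsqE (bigD1 j) //= lerDl sumr_ge0 // => i _.
    by rewrite exprn_ge0.
  by rewrite mxE normC2_rect ?rp_valP // -!rmorphXn -rmorphD.
have sqM (a : realpart C) : a ^+ 2 <= M ^+ 2 -> `|a| <= M.
  by rewrite -(@ler_pXn2r _ 2 _ `|a|) ?nnegrE // real_normK ?num_real.
move=> i; have [lt_in|le_ni] := ltnP i n.
  apply/sqM/(le_trans _ (entry (Ordinal lt_in))).
  by rewrite lerDl sqr_ge0.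
have [lt_i|le_i] := ltnP i (n + n); last by rewrite nth_default ?sl // normr0.
have lt_j : (i - n < n)%N by rewrite ltn_subLR.
apply/sqM/(le_trans _ (entry (Ordinal lt_j))).
by rewrite /= subnKC // lerDr sqr_ge0.
Qed.

Lemma vnorm_le (n : nat) (z : 'cV[C]_n) d : 0 <= d ->
  (vnorm z <= d) = (nsq z <= d ^+ 2).
Proof.
by move=> d0; rewrite -(@ler_pXn2r _ 2) ?nnegrE ?sqrtC_ge0 ?nsq_ge0 // sqrtCK.
Qed.

Lemma scaled_ball (n : nat) (z : 'cV[C]_n) d : 0 <= d ->
  vnorm z <= d <-> exists2 u, z = d *: u & nsq u <= 1.
Proof.
move=> d0; rewrite vnorm_le //; split=> [zd|[u -> u1]]; last first.
  by rewrite nsqZ ger0_norm // ler_piMr // exprn_ge0.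
(* A ball of radius 0 contains only 0, and [u = 0] represents it. *)
have [d_0|d_n0] := eqVneq d 0.
  exists 0; first by rewrite scaler0 (@nsq_le0 _ z) // (le_trans zd) // d_0 expr0n.
  by rewrite nsqE big1 ?ler01 // => i _; rewrite mxE normr0 expr0n.
exists (d^-1 *: z); first by rewrite scalerA divff // scale1r.
rewrite nsqZ normfV ger0_norm // exprVn mulrC ler_pdivrMr ?mul1r //.
by rewrite exprn_gt0 // lt_def d_n0.
Qed.

Lemma nsq_scalar (t : C) : nsq (t%:M : 'M_1) = `|t| ^+ 2.
Proof. by rewrite nsqE big_ord1 mxE eqxx mulr1n. Qed.

Variable p : nat.
Implicit Types (t : 'M[C]_1) (u v : 'cV[C]_p) (z : 'cV[C]_(1 + (p + p))).

Definition diag3 (a b c : C) : 'M[C]_(1 + (p + p)) :=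
  block_mx a%:M 0 0 (block_mx b%:M 0 0 c%:M).

Lemma ctr_diag3 a b c : a \is Num.real -> b \is Num.real -> c \is Num.real ->
  ctr (diag3 a b c) = diag3 a b c.
Proof. by move=> aR bR cR; rewrite /diag3 !ctr_block_mx !ctr0 !ctr_scalar. Qed.

Lemma form_diag3 a b c t u v : form (diag3 a b c) (col_mx t (col_mx u v)) =
  a * nsq t + b * nsq u + c * nsq v.
Proof.
have entD (A B : 'M[C]_1) : (A + B) 0 0 = A 0 0 + B 0 0 by rewrite mxE.
have entZ d (A : 'M[C]_1) : (d *: A) 0 0 = d * A 0 0 by rewrite mxE.
rewrite /form !ctr_col_mx /diag3 !mul_row_block !mulmx0 !addr0 !add0r !mul_mx_scalar.
by rewrite !mul_row_col -!scalemxAl !entD !entZ addrA.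
Qed.

(** The homogenized unit-ball constraints, on [u] here and on [v] in [ball2_mx]. *)
Definition ball1_mx : 'M[C]_(1 + (p + p)) := diag3 1 (- 1) 0.
Definition ball2_mx : 'M[C]_(1 + (p + p)) := diag3 1 0 (- 1).

Lemma ctr_ball1_mx : ctr ball1_mx = ball1_mx.
Proof. by rewrite ctr_diag3 ?rpredN ?rpred0 ?rpred1. Qed.

Lemma ctr_ball2_mx : ctr ball2_mx = ball2_mx.
Proof. by rewrite ctr_diag3 ?rpredN ?rpred0 ?rpred1. Qed.

Lemma form_ball1_mx (t : C) u v :
  form ball1_mx (col_mx t%:M (col_mx u v)) = `|t| ^+ 2 - nsq u.
Proof. by rewrite form_diag3 nsq_scalar; ring. Qed.

Lemma form_ball2_mx (t : C) u v :
  form ball2_mx (col_mx t%:M (col_mx u v)) = `|t| ^+ 2 - nsq v.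
Proof. by rewrite form_diag3 nsq_scalar; ring. Qed.

Lemma col_mx3P z : exists (t : C) u v, z = col_mx t%:M (col_mx u v).
Proof.
exists (usubmx z 0 0), (usubmx (dsubmx z)), (dsubmx (dsubmx z)).
by rewrite -mx11_scalar !vsubmxK.
Qed.

(** There is nothing at infinity: [t = 0] forces [u = v = 0]. Otherwise division by [t] leads back
    to the balls. *)
Lemma homogeneous_ballP z : 0 <= form ball1_mx z -> 0 <= form ball2_mx z ->
  z = 0 \/ exists (t : C) u v, [/\ t != 0,
    z = t *: col_mx 1%:M (col_mx u v), nsq u <= 1 & nsq v <= 1].
Proof.
have [t [u [v ->]]] := col_mx3P z.
rewrite form_ball1_mx form_ball2_mx !subr_ge0 => ut vt.
have [t0|t_n0] := eqVneq t 0; [left | right].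
  rewrite t0 normr0 expr0n /= in ut vt.
  by rewrite t0 (nsq_le0 ut) (nsq_le0 vt) raddf0 !col_mx0.
exists t, (t^-1 *: u), (t^-1 *: v); split=> //.
- by rewrite !scale_col_mx !scalerA divff // !scale1r scale_scalar_mx mulr1.
- by rewrite nsqZ normfV exprVn mulrC ler_pdivrMr ?mul1r // exprn_gt0 ?normr_gt0.
- by rewrite nsqZ normfV exprVn mulrC ler_pdivrMr ?mul1r // exprn_gt0 ?normr_gt0.
Qed.
End ConjugateTranspose.

(** * The robust constraint at a fixed [x] *)

Section Robust.
Variables (C : numClosedFieldType) (m n p : nat).
Variables (H : 'M[C]_(m, n)) (Hs : 'I_p -> 'M[C]_(m, n)).
Variables (y : 'cV[C]_m) (ys : 'I_p -> 'cV[C]_m) (Hp : 'M[C]_(n, m)).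
Variables (da db : C) (x : 'cV[C]_n).
Hypotheses (pinvH : is_pinv H Hp) (da0 : 0 <= da) (db0 : 0 <= db).

Local Notation kap := (kappa H y Hp).
Local Notation d := (dvec H Hs y Hp).
Local Notation b := (bvec H y ys Hp).
Local Notation G := (Gmat Hs x).
Local Notation Q := (Qmat ys).
Local Notation r := (y - H *m x).
Local Notation Rs := (Rs H Hs y ys Hp x).
Local Notation LMI := (LMI H Hs y ys Hp da db).

Definition residual_mx : 'M[C]_(m, 1 + (p + p)) :=
  row_mx r (row_mx (- (da *: G)) (db *: Q)).

Definition linear_mx (g : C) : 'M[C]_(1 + (p + p)) :=
  block_mx (g + kap)%:M (row_mx (da *: ctr d) (db *: ctr b))
    (col_mx (da *: d) (db *: b)) 0.

(** The matrix of [F0]. It is also the Schur complement of the identity block once the multiplier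
    terms are removed. *)
Definition margin_mx (g : C) : 'M[C]_(1 + (p + p)) :=
  linear_mx g - ctr residual_mx *m residual_mx.

(** The pseudo-inverse makes [H *m Hp], hence [P], Hermitian. *)
Lemma kappa_real : kap \is Num.real.
Proof.
apply/CrealP; have -> : kap^* = ctr (ctr y *m Pproj H Hp *m y) 0 0.
  by rewrite [RHS]mxE [in RHS]mxE.
have [_ _ hP _] := pinvH.
by rewrite !ctrM ctrK mulmxA /Pproj ctrD ctrN ctr_scalar ?rpred1 // hP.
Qed.

Lemma ctr_margin_mx g : g \is Num.real -> ctr (margin_mx g) = margin_mx g.
Proof.
move=> gR; rewrite ctrD ctrN ctrM ctrK; congr (_ - _).
rewrite ctr_block_mx ctr_col_mx ctr_row_mx !ctrZ !ctrK ctr0.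
by rewrite ctr_scalar ?rpredD ?kappa_real // !conj_Creal ?ger0_real.
Qed.

Lemma residual_mxE u v (t : C) : residual_mx *m col_mx t%:M (col_mx u v) =
  t *: r - da *: (G *m u) + db *: (Q *m v).
Proof.
by rewrite !mul_row_col mul_mx_scalar mulNmx -!scalemxAl addrA.
Qed.

Lemma perturbed_residual a c :
  ytilde y ys c - Htilde H Hs a *m x = r - G *m a + Q *m c.
Proof.
have -> : Q *m c = \sum_i c i 0 *: ys i.
  apply/colP => i; rewrite mxE summxE; apply: eq_bigr => j _.
  by rewrite !mxE mulrC.
have -> : G *m a = (\sum_i a i 0 *: Hs i) *m x.
  rewrite mulmx_suml; apply/colP => i; rewrite mxE summxE; apply: eq_bigr => j _.
  by rewrite -scalemxAl [in RHS]mxE [in LHS]mxE mulrC.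
rewrite /ytilde /Htilde mulmxDl opprD addrACA.
by rewrite [RHS]addrAC -[RHS]addrA.
Qed.

Let entD (A B : 'M[C]_1) : (A + B) 0 0 = A 0 0 + B 0 0. Proof. by rewrite mxE. Qed.
Let entZ e (A : 'M[C]_1) : (e *: A) 0 0 = e * A 0 0. Proof. by rewrite mxE. Qed.
Let entN (A : 'M[C]_1) : (- A) 0 0 = - A 0 0. Proof. by rewrite mxE. Qed.

Lemma form_gram_mx (k l : nat) (A : 'M[C]_(k, l)) z : form (ctr A *m A) z = nsq (A *m z).
Proof. by rewrite /nsq ctrM /form !mulmxA. Qed.

Lemma form_margin_mx g u v :
  form (margin_mx g) (col_mx 1%:M (col_mx u v)) = g - Rs (da *: u) (db *: v).
Proof.
rewrite formD formN form_gram_mx residual_mxE scale1r.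
rewrite /Rs /vnorm sqrtCK perturbed_residual -!scalemxAr.
rewrite -/(nsq _) /form !ctr_col_mx ctr_scalar ?rpred1 // mul_row_block mul_row_col.
rewrite mul1mx mulmx0 addr0 mulmxDl !mul_row_col mul1mx !mulmx1.
rewrite !ctrZ !conj_Creal ?ger0_real // !mul_row_col -!scalemxAr -!scalemxAl !(entD, entZ).
by rewrite [_%:M _ _]mxE eqxx mulr1n; ring.
Qed.

(* Completing the square in the coordinate [w] of the identity block. *)
Lemma form_LMI g t1 t2 (t : C) w u v :
  form (LMI g t1 t2 x) (col_mx (col_mx t%:M w) (col_mx u v)) =
  nsq (w + residual_mx *m col_mx t%:M (col_mx u v))
  + form (margin_mx g - diag3 p (t1 + t2) (- t1) (- t2)) (col_mx t%:M (col_mx u v)).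
Proof.
have ctrt : ctr (t%:M : 'M_1) = (t^*)%:M.
  by rewrite /ctr tr_scalar_mx map_scalar_mx.
rewrite !(formD, formN) form_gram_mx form_diag3 residual_mxE /nsq.
have [daC dbC] : da^* = da /\ db^* = db by rewrite !conj_Creal ?ger0_real.
(* Generalizing the residual keeps distributivity from expanding it. *)
rewrite /form /LMI /linear_mx; move: r => rr.
rewrite !ctrD !(ctrN, ctrZ, ctrM) daC dbC.
rewrite !ctr_col_mx ctrt !mul_row_block !mul_row_col.
rewrite !(mulmxDl, mulmxDr, mulmxN, mulNmx, mulmxA, mul_mx_scalar).
rewrite !(mul_scalar_mx, mulmx1, mul1mx, mulmx0, mul0mx).
rewrite -?(scalemxAl, scalemxAr) ?mul_row_col ?(addr0, add0r).
rewrite !(mulmxDl, mulNmx, mulmxA, mul_mx_scalar) -!scalemxAl.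
rewrite !(entD, entN, entZ) [(_%:M : 'M_1) _ _]mxE eqxx mulr1n.
by ring.
Qed.

(** The common center of the balls is the Slater point. *)
Lemma rform_ball1 : rform (ball1_mx C p) (col_mx 1%:M 0) = 1.
Proof.
have -> : (0 : 'cV[C]_(p + p)) = col_mx 0 0 by rewrite -[LHS]vsubmxK !raddf0.
apply/val_inj/(etrans (formE _ (ctr_ball1_mx C p))); rewrite form_ball1_mx.
by rewrite normr1 expr1n nsqE big1 ?subr0 // => i _; rewrite mxE normr0 expr0n.
Qed.

Lemma rform_ball2 : rform (ball2_mx C p) (col_mx 1%:M 0) = 1.
Proof.
have -> : (0 : 'cV[C]_(p + p)) = col_mx 0 0 by rewrite -[LHS]vsubmxK !raddf0.
apply/val_inj/(etrans (formE _ (ctr_ball2_mx C p))); rewrite form_ball2_mx.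
by rewrite normr1 expr1n nsqE big1 ?subr0 // => i _; rewrite mxE normr0 expr0n.
Qed.

Lemma ctr_LMI g t1 t2 : g \is Num.real -> t1 \is Num.real -> t2 \is Num.real ->
  ctr (LMI g t1 t2 x) = LMI g t1 t2 x.
Proof.
move=> gR t1R t2R.
rewrite !ctr_block_mx !ctr_scalar ?rpredB ?rpredD ?rpred1 ?kappa_real //.
by rewrite !(ctrN, ctrZ) !ctrK !ctr0 !(@conj_Creal _ da) ?(@conj_Creal _ db) ?ger0_real.
Qed.

Lemma admissible_ball a c : admissible da db a c <->
  exists u v : 'cV[C]_p, [/\ a = da *: u, c = db *: v, nsq u <= 1 & nsq v <= 1].
Proof.
split=> [[/(scaled_ball _ da0)[u -> u1] /(scaled_ball _ db0)[v -> v1]]|]; first by exists u, v.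
move=> [u [v [-> -> u1 v1]]].
by split; [apply/(scaled_ball _ da0); exists u | apply/(scaled_ball _ db0); exists v].
Qed.

(** [- Rs] is a value of the Hermitian form [margin_mx 0]. Realness allows a worst value to serve as
    a level [g]. *)
Lemma Rs_real a c : admissible da db a c -> Rs a c \is Num.real.
Proof.
move=> /admissible_ball[u [v [-> -> _ _]]].
have := form_margin_mx 0 u v; rewrite sub0r => /(canLR (@opprK _)) <-.
by rewrite rpredN -formE ?rp_valP // ctr_margin_mx ?rpred0.
Qed.

Theorem robust_LMI g : g \is Num.real ->
  (forall a c, admissible da db a c -> Rs a c <= g) <->
  exists t1 t2, [/\ 0 <= t1, 0 <= t2 & psd (LMI g t1 t2 x)].
Proof.
move=> gR; split=> [Rsg|[t1 [t2 [t10 t20 [_ LMI0]]]] a c]; last first.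
  move=> /admissible_ball[u [v [-> -> u1 v1]]].
  (* This [w] annihilates the completed square and leaves the Schur complement. *)
  pose w := - (residual_mx *m col_mx 1%:M (col_mx u v)).
  have := LMI0 (col_mx (col_mx 1%:M w) (col_mx u v)).
  rewrite -/(form _ _) form_LMI addNr formD formN form_margin_mx form_diag3.
  rewrite nsq_scalar normr1 expr1n nsqE big1 => [|i _]; last first.
    by rewrite mxE normr0 expr0n.
  rewrite add0r => LMIw; rewrite -subr_ge0; apply: le_trans LMIw _.
  have -> : g - Rs (da *: u) (db *: v) - ((t1 + t2) * 1 + - t1 * nsq u + - t2 * nsq v)
    = g - Rs (da *: u) (db *: v) - (t1 * (1 - nsq u) + t2 * (1 - nsq v)) by ring.
  by rewrite gerBl addr_ge0 // mulr_ge0 // subr_ge0.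
have hM := ctr_margin_mx gR.
have [|||s1 [s2 [s10 s20 sP]]] := @S_lemma C _ (margin_mx g) (ball1_mx C p) (ball2_mx C p)
  (col_mx 1%:M 0).
- by rewrite rform_ball1.
- by rewrite rform_ball2.
- move=> z; rewrite !rform_ge0 ?ctr_ball1_mx ?ctr_ball2_mx // => b1 b2.
  (* By homogeneity only points with first coordinate 1 have to be tested. *)
  have [->|[t [u [v [t0 -> u1 v1]]]]] := homogeneous_ballP b1 b2.
    by rewrite /form mulmx0 mxE.
  rewrite formZ form_margin_mx mulr_ge0 ?exprn_ge0 // subr_ge0 Rsg //.
  by apply/admissible_ball; exists u, v.
exists (rp_val s1), (rp_val s2); split=> //; split; first exact: ctr_LMI (rp_valP _) (rp_valP _).
move=> z; rewrite -(vsubmxK z) -[usubmx z]vsubmxK -[dsubmx z]vsubmxK.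
rewrite [usubmx (usubmx z)]mx11_scalar -/(form _ _) form_LMI addr_ge0 ?nsq_ge0 //.
set z' := col_mx _ (col_mx _ _).
have : rp_val s1 * rp_val (rform (ball1_mx C p) z')
    + rp_val s2 * rp_val (rform (ball2_mx C p) z')
  <= rp_val (rform (margin_mx g) z') := sP z'.
rewrite !formE ?ctr_ball1_mx ?ctr_ball2_mx // -subr_ge0.
rewrite form_ball1_mx form_ball2_mx formD formN form_diag3 nsq_scalar.
move/le_trans; apply; rewrite le_eqVlt; apply/orP; left; apply/eqP; ring.
Qed.

(** Maximizing [Rs] is minimizing the form [margin_mx 0] on the points with [|t| = 1] in both
    homogenized balls; the phase of [t] does not affect the form. *)
Lemma worst_case_attained : exists v, worst_value H Hs y ys Hp da db x v.
Proof.
have hM : ctr (margin_mx 0) = margin_mx 0 by rewrite ctr_margin_mx ?rpred0.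
pose apex := diag3 p (1 : C) 0 0.
have hA : ctr apex = apex by rewrite ctr_diag3 ?rpred0 ?rpred1.
have form_apex (t : C) u v : form apex (col_mx t%:M (col_mx u v)) = `|t| ^+ 2.
  by rewrite form_diag3 nsq_scalar; ring.
pose N := (1 + (p + p))%N; pose dec : seq (realpart C) -> 'cV[C]_N := @decode C N.
(* The equation [|t|^2 = 1] is split into two inequalities, so that definability and closedness come
   from the same kind of condition. *)
pose feasible l := [/\ 0 <= rform (ball1_mx C p) (dec l),
  0 <= rform (ball2_mx C p) (dec l), 0 <= 1 - rform apex (dec l) &
  0 <= rform apex (dec l) - 1].
have feasibleP l : feasible l <-> exists (t : C) u v, [/\ `|t| = 1,
  dec l = t *: col_mx 1%:M (col_mx u v), nsq u <= 1 & nsq v <= 1].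
  split=> [[b1 b2 a1 a2]|[t [u [v [t1 lE u1 v1]]]]].
    have ra : rform apex (dec l) = 1 by apply/le_anti; rewrite -subr_ge0 a1 -subr_ge0.
    have fa : form apex (dec l) = 1 by rewrite -formE // ra.
    move: b1 b2; rewrite !rform_ge0 ?ctr_ball1_mx ?ctr_ball2_mx // => b1 b2.
    have [l0|[t [u [v [_ lE u1 v1]]]]] := homogeneous_ballP b1 b2.
      by move/eqP: fa; rewrite l0 /form mulmx0 mxE eq_sym oner_eq0.
    exists t, u, v; split=> //; move: fa; rewrite lE formZ form_apex normr1 expr1n mulr1.
    by move/eqP; rewrite pexpr_eq1 // => /eqP.
  have ra : rform apex (dec l) = 1.
    apply/val_inj/(etrans (formE _ hA)); rewrite lE formZ form_apex t1 normr1.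
    by rewrite !expr1n mulr1.
  split; rewrite ?ra ?subrr // rform_ge0 ?ctr_ball1_mx ?ctr_ball2_mx // lE formZ.
    by rewrite form_ball1_mx t1 normr1 !expr1n mul1r subr_ge0.
  by rewrite form_ball2_mx t1 normr1 !expr1n mul1r subr_ge0.
have pb1 : polyfun (fun l => rform (ball1_mx C p) (dec l)) by exact: polyfun_rform.
have pb2 : polyfun (fun l => rform (ball2_mx C p) (dec l)) by exact: polyfun_rform.
have pa1 : polyfun (fun l => 1 - rform apex (dec l)).
  exact: polyfunB (polyfun_const _) (polyfun_rform _).
have pa2 : polyfun (fun l => rform apex (dec l) - 1).
  exact: polyfunB (polyfun_rform _) (polyfun_const _).
have encP u v : nsq u <= 1 -> nsq v <= 1 ->
    feasible (encode (col_mx 1%:M (col_mx u v) : 'cV[C]_N)).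
  move=> u1 v1; apply/feasibleP; exists 1, u, v.
  by rewrite /dec encodeK scale1r normr1.
have [||||||l [sl lP lmin]] := @polyfun_attains_min _ (N + N) feasible
    (fun l => rform (margin_mx 0) (dec l)) 2 (encode (col_mx 1%:M 0 : 'cV[C]_N)).
- have dle (F : seq (realpart C) -> realpart C) : polyfun F ->
      definable (N + N) (fun l => 0 <= F l) by exact: definable_le (polyfun_const _).
  apply: definable_ext (definable_and (definable_and (dle _ pb1) (dle _ pb2))
    (definable_and (dle _ pa1) (dle _ pa2))) => l _.
  by split=> [[[? ?] [? ?]]|[]].
- have cl := closed_set_and (closed_set_and (@polyfun_ge0_closed _ (N + N) _ pb1)
    (@polyfun_ge0_closed _ (N + N) _ pb2))
    (closed_set_and (@polyfun_ge0_closed _ (N + N) _ pa1)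
      (@polyfun_ge0_closed _ (N + N) _ pa2)).
  move=> l /cl{}cl lP; case: cl => [t /lP[l' sl' [[h1 h2 h3 h4] h]]|[? ?] [? ?]] //.
  by exists l'.
- move=> l sl /feasibleP[t [u [v [t1 lE u1 v1]]]].
  (* The squared norm is at most [1 + 1 + 1], which is below [2 ^+ 2]. *)
  apply: (@decode_bounded _ N _ 2) => //; rewrite -/(dec l) lE nsqZ t1 expr1n mul1r.
  have -> : nsq (col_mx 1%:M (col_mx u v)) = 1 + nsq u + nsq v.
    by rewrite /nsq !ctr_col_mx !mul_row_col addrA ctr_scalar ?rpred1 // mul1mx !entD [_%:M _ _]mxE.
  have -> : rp_val (2 ^+ 2) = 1 + 1 + 1 + 1 :> C by rewrite rmorphXn rmorph_nat; ring.
  by apply: le_trans (lerD (lerD (lexx 1) u1) v1) _; rewrite lerDl ler01.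
- exact: size_encode.
- have -> : (0 : 'cV[C]_(p + p)) = col_mx 0 0 by rewrite -[LHS]vsubmxK !raddf0.
  by apply: encP; rewrite nsqE big1 ?ler01 // => i _; rewrite mxE normr0 expr0n.
- exact: polyfun_rform.
have /feasibleP[t [u [v [t1 lE u1 v1]]]] := lP.
exists (Rs (da *: u) (db *: v)); split.
  by exists (da *: u), (db *: v); split=> //; apply/admissible_ball; exists u, v.
move=> a c /admissible_ball[u' [v' [-> -> u'1 v'1]]].
have := lmin _ (size_encode _) (encP _ _ u'1 v'1); rewrite /dec encodeK -/(dec l).
move=> lm; have {lm}: rp_val (rform (margin_mx 0) (dec l)) <= rp_val (rform (margin_mx 0)
   (col_mx 1%:M (col_mx u' v'))) := lm.
rewrite !formE // lE formZ t1 expr1n mul1r !form_margin_mx.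
by rewrite !sub0r lerN2.
Qed.
End Robust.

(** The optimal values are relations, so the second claim says that either minimum is attained
    exactly when the other is, with the same value. *)
Theorem theorem3 (C : numClosedFieldType) (m n p : nat)
  (H : 'M[C]_(m, n)) (Hs : 'I_p -> 'M[C]_(m, n))
  (y : 'cV[C]_m) (ys : 'I_p -> 'cV[C]_m) (Hp : 'M[C]_(n, m))
  (da db : C) :
  (n <= m)%N -> \rank H = n -> is_pinv H Hp -> 0 <= da -> 0 <= db ->
  (forall (x : 'cV[C]_n) (g : C), g \is Num.real ->
     ((forall a b : 'cV[C]_p, admissible da db a b -> Rs H Hs y ys Hp x a b <= g)
      <-> (exists t1 t2 : C, [/\ 0 <= t1, 0 <= t2 &
             psd (LMI H Hs y ys Hp da db g t1 t2 x)])))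
  /\ (forall v : C, minmax_value H Hs y ys Hp da db v <-> sdp_value H Hs y ys Hp da db v).
Proof.
move=> _ _ pinvH da0 db0.
have robust x g := @robust_LMI C m n p H Hs y ys Hp da db x pinvH da0 db0 g.
have worst x := worst_case_attained Hs y ys x pinvH da0 db0.
have worst_real x w : worst_value H Hs y ys Hp da db x w -> w \is Num.real.
  by move=> [[a [b [adm <-]]] _]; exact: (Rs_real Hs y ys x pinvH da0 db0 adm).
have worst_feasible x w : worst_value H Hs y ys Hp da db x w ->
    exists t1 t2, lmi_feasible H Hs y ys Hp da db w x t1 t2.
  move=> xw; have wR := worst_real x w xw.
  by have [t1 [t2 [t10 t20 LMI0]]] := (robust x w wR).1 xw.2; exists t1, t2.
have feasible_worst x g w t1 t2 : lmi_feasible H Hs y ys Hp da db g x t1 t2 ->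
    worst_value H Hs y ys Hp da db x w -> w <= g.
  move=> [gR t10 t20 LMI0] [[a [b [adm <-]]] _]; apply: (robust x g gR).2 adm.
  by exists t1, t2.
split=> [x g gR|v]; first exact: robust.
split=> [[[x xv] vmin]|[[x [t1 [t2 feas]]] vmin]].
  split; first by exists x; exact: worst_feasible.
  (* The worst value at [x'] exists and lies between [v] and the feasible level [g]. *)
  move=> g x' t1 t2 feas; have [w x'w] := worst x'.
  exact: le_trans (vmin _ _ x'w) (feasible_worst _ _ _ _ _ feas x'w).
have vmin' x' w : worst_value H Hs y ys Hp da db x' w -> v <= w.
  by move=> /worst_feasible[s1 [s2 /vmin]].
split=> //; have [w xw] := worst x; exists x.
(* [v] is feasible at [x], hence at least [w]; and [w] is itself a feasible level, hence at least
   [v]. *)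
suff -> : v = w by [].
by apply/le_anti; rewrite (vmin' _ _ xw) (feasible_worst _ _ _ _ _ feas xw).
Qed.
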